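(* Let $(M^7,\eta,\Phi,\Upsilon)$ be a contact Calabi--Yau $7$-manifold such that $\omega=d\eta$ is transverse Ricci-flat and $|\Upsilon|_\omega=1$. Let $\epsilon>0$ and, for $0\le t<\frac{1}{5\epsilon^2}$, consider the functions $$a_t=\epsilon(1-5\epsilon^2t)^{-\frac{3}{10}},\qquad b_t=(1-5\epsilon^2t)^{\frac{1}{10}} .$$ Then the family of $\mathrm{G}_2$-structures $$\varphi_t=b_t^3\,\mathrm{Re}\,\Upsilon+a_tb_t^2\,\eta\wedge\omega$$ satisfies the modified Laplacian coflow with constant $A=0$.
   Context: A Sasakian structure $(\xi,\eta,\Phi,g)$ on $M^7$: $\xi$ (Reeb field) is a vector field, $\eta$ (contact form) a $1$-form, $\Phi$ a $(1,1)$-tensor with $\eta(\xi)=1$, $\Phi^2=-\mathrm{Id}+\eta\otimes\xi$, $\eta\wedge(d\eta)^3\neq0$, $g$ a metric with $g(\Phi X,\Phi Y)=g(X,Y)-\eta(X)\eta(Y)$, $g=d\eta\circ(1\otimes\Phi)+\eta\otimes\eta$, such that the cone $(\mathbb{R}_{>0}\times M,dr^2+r^2g)$ is Kähler. A form $\alpha$ is basic if $\xi\lrcorner\alpha=0$ and $\mathcal{L}_\xi\alpha=0$. $\Phi$ induces an (integrable) transverse complex structure on $\mathcal{D}=\ker\eta$, giving types $(p,q)$ on basic forms. A contact Calabi--Yau $7$-manifold $(M^7,\eta,\Phi,\Upsilon)$ is a $7$-dimensional Sasakian manifold with vanishing first basic Chern class $c_1^B(M)=0$ and a nowhere-vanishing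 closed transverse (basic) form $\Upsilon$ of type $(3,0)$ on $\mathcal{D}$; with $\omega=d\eta$, $|\Upsilon|_\omega>0$ is defined by $\frac{\omega^3}{3!}=\frac{i}{8}\frac{1}{|\Upsilon|^2_\omega}\Upsilon\wedge\overline{\Upsilon}$ (it is constant when $\omega$ is transverse Ricci-flat). A $\mathrm{G}_2$-structure $\varphi\in\Omega^3(M^7)$ determines a metric $g_\varphi$ and volume form by $(X\lrcorner\varphi)\wedge(Y\lrcorner\varphi)\wedge\varphi=6g_\varphi(X,Y)\mathrm{vol}_\varphi$, a Hodge star $\ast_\varphi$, the dual $4$-form $\psi=\ast_\varphi\varphi$, and the scalar torsion $\tau_0=\frac17\ast_\varphi(\varphi\wedge d\varphi)$. A family $\varphi_t$ solves the modified Laplacian coflow with constant $A$ if $\psi_t=\ast_t\varphi_t$ satisfies $$\frac{\partial}{\partial t}\psi_t=\Delta_t\psi_t+d\Big(\big(A-\tfrac72(\tau_0)_t\big)\varphi_t\Big),$$ where $\Delta_t=dd^{\ast_t}+d^{\ast_t}d$ is the Hodge Laplacian of $g_{\varphi_t}$. *)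

(* Defs.v *)
From mathcomp Require Import all_boot all_order all_algebra perm.
From mathcomp Require Import all_classical all_reals all_analysis.
From mathcomp.real_closed Require Import complex.

Set Implicit Arguments.
Unset Strict Implicit.
Unset Printing Implicit Defensive.

Import Order.TTheory GRing.Theory Num.Theory.
Import numFieldNormedType.Exports.

Local Open Scope classical_set_scope.
Local Open Scope ring_scope.

(* Conventions.  The library has no manifolds, so a manifold is a topological
   space with a smooth atlas, and a tensor field is the family of its
   coordinate expressions in the charts, subject to the transformation law
   under change of charts.  Tangent vectors are row vectors and linear maps act
   on them on the right.  A k-form at a point of R^n is a function of a k x n
   matrix, whose rows are the k arguments; evaluation is normalised so that
   (dx /\ dy)(d/dx, d/dy) = 1, that is,
     d eta (X, Y) = X (eta Y) - Y (eta X) - eta [X, Y].                     *)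

Section Local.
Context {R : realType}.

Definition smooth_on {n} {W : normedModType R} (U : set 'rV[R]_n)
    (f : 'rV[R]_n -> W) : Prop :=
  forall (s : seq 'rV[R]_n) x, U x ->
    differentiable (foldr (fun v h y => 'D_v h y) f s) x.

Definition lvfield n := 'rV[R]_n -> 'rV[R]_n.
Definition lform (L : Type) n k := 'rV[R]_n -> 'M[R]_(k, n) -> L.
Definition lendo n := 'rV[R]_n -> 'M[R]_n.

Definition lie_bracket {n} (X Y : lvfield n) : lvfield n :=
  fun x => 'D_(X x) Y x - 'D_(Y x) X x.

Definition inner {n} (G : 'M[R]_n) (u w : 'rV[R]_n) : R :=
  (u *m G *m w^T) 0 0.

Definition posdef {n} (G : 'M[R]_n) : Prop :=
  G^T = G /\ forall u, u != 0 -> 0 < inner G u u.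

Definition alternating {k n} (a : 'M[R]_(k, n) -> R) : Prop :=
  (forall (A B C : 'M[R]_(k, n)) (i : 'I_k) (b c : R),
     row i A = b *: row i B + c *: row i C ->
     (forall j, j != i -> row j B = row j A /\ row j C = row j A) ->
     a A = b * a B + c * a C) /\
  (forall (A : 'M[R]_(k, n)) (i j : 'I_k),
     i != j -> row i A = row j A -> a A = 0).

(* The coefficients may lie in an extension L of R, so that this covers
   complex-valued forms. *)
Definition wedge {L : fieldType} {n k l} (a : 'M[R]_(k, n) -> L)
    (b : 'M[R]_(l, n) -> L) : 'M[R]_(k + l, n) -> L :=
  fun v => (k`! * l`!)%:R^-1 *
    \sum_(s : 'S_(k + l)) (-1) ^+ s * a (usubmx (row_perm s v))
                                    * b (dsubmx (row_perm s v)).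

Definition contract {L : Type} {n k} (X : 'rV[R]_n)
    (a : 'M[R]_(k.+1, n) -> L) : 'M[R]_(k, n) -> L :=
  fun w => a (col_mx X w : 'M[R]_(1 + k, n)).

Definition extd {n k} (a : lform R n k) : lform R n k.+1 :=
  fun x v => \sum_(j < k.+1)
    (-1) ^+ j * 'D_(row j v) (fun y => a y (row' j v)) x.

Definition lie_deriv {n k} (X : lvfield n) (a : lform R n k) : lform R n k :=
  fun x v => 'D_(X x) (fun y => a y v) x -
    \sum_(j < k) a x (\matrix_(m < k)
       (if m == j then lie_bracket X (fun=> row j v) x else row m v)).

(* In coordinates,
   ( *b )_{j..} = 1/k! sum_{i1..ik} b^{i1..ik} vol_{i1..ik j..}, the indices of
   b being raised with the inverse metric; equivalently
   a /\ *b = <a, b> vol.  Since k + (n - k) = n for k <= n, [conform_mx] only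
   adjusts the type of the argument of [vol]. *)
Definition star {n k} (G : 'M[R]_n) (vol : 'M[R]_(n, n) -> R)
    (b : 'M[R]_(k, n) -> R) : 'M[R]_(n - k, n) -> R :=
  fun w => (k`!)%:R^-1 *
    \sum_(f : {ffun 'I_k -> 'I_n})
       b (rowsub f (invmx G)) *
       vol (conform_mx 0 (col_mx (rowsub f (1%:M : 'M[R]_n)) w)).

Definition codiff {n k} (G : lendo n) (vol : lform R n n) (a : lform R n k) :
    lform R n (n - (n - k).+1) :=
  fun x w => (-1) ^+ (n * k.+1).+1 *
    star (G x) (vol x) (extd (fun y => star (G y) (vol y) (a y)) x) w.

(* Hodge Laplacian on 4-forms in dimension 7; the degrees agree by
   computation. *)
Definition hodge_laplacian (G : lendo 7) (vol : lform R 7 7)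
    (a : lform R 7 4) : lform R 7 4 :=
  fun x v => extd (codiff G vol a : lform R 7 3) x v +
             (codiff G vol (extd a) : lform R 7 4) x v.

Definition act {m} (J : lendo m) (X : lvfield m) : lvfield m :=
  fun x => X x *m J x.

Definition nijenhuis {m} (J : lendo m) (X Y : lvfield m) : lvfield m :=
  fun x => lie_bracket (act J X) (act J Y) x
         - act J (lie_bracket (act J X) Y) x
         - act J (lie_bracket X (act J Y)) x
         - lie_bracket X Y x.

Record kahler_on {m} (U : set 'rV[R]_m) (G J : lendo m) : Prop := {
  kahler_metric_smooth : smooth_on U G;
  kahler_metric_pos : forall x, U x -> posdef (G x);
  kahler_cpx_smooth : smooth_on U J;
  kahler_cpx : forall x, U x -> J x *m J x = - 1%:M;
  kahler_integrable : forall X Y : lvfield m, smooth_on U X -> smooth_on U Y ->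
    forall x, U x -> nijenhuis J X Y x = 0;
  kahler_hermitian : forall x, U x -> forall u w,
    inner (G x) (u *m J x) (w *m J x) = inner (G x) u w;
  kahler_closed : forall x, U x -> forall v,
    extd (fun y (w : 'M[R]_(2, m)) =>
            inner (G y) (row 0 w *m J y) (row 1 w)) x v = 0 }.

(* Cone over a coordinate domain of R^n: the coordinates are (r, x), and
   vectors are s d/dr + X.  The metric is dr^2 + r^2 g. *)
Definition cone_dom {n} (U : set 'rV[R]_n) : set 'rV[R]_(1 + n) :=
  [set y | 0 < lsubmx y 0 0 /\ U (rsubmx y)].

Definition cone_metric {n} (G : lendo n) : lendo (1 + n) :=
  fun y => block_mx 1%:M 0 0 ((lsubmx y 0 0) ^+ 2 *: G (rsubmx y)).

(* The cone complex structure induced by (xi, eta, Phi):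
   J (r d/dr) = xi and J X = Phi X - eta (X) r d/dr. *)
Definition cone_cpx {n} (xi : lvfield n) (eta : lform R n 1) (Phi : lendo n) :
    lendo (1 + n) :=
  fun y => let r := lsubmx y 0 0 in let x := rsubmx y in
    block_mx 0 (r^-1 *: xi x)
             (- r *: \col_j eta x (delta_mx 0 j)) (Phi x).

Definition christoffel {n} (G : lendo n) (x : 'rV[R]_n) (i j k : 'I_n) : R :=
  2^-1 * \sum_(l < n) invmx (G x) k l *
    ('D_(delta_mx 0 i) (fun y => G y j l) x
     + 'D_(delta_mx 0 j) (fun y => G y i l) x
     - 'D_(delta_mx 0 l) (fun y => G y i j) x).

Definition levi_civita {n} (G : lendo n) (X Y : lvfield n) : lvfield n :=
  fun x => 'D_(X x) Y x +
    \row_k \sum_(i < n) \sum_(j < n) christoffel G x i j k * X x 0 i * Y x 0 j.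

Definition horiz {n} (xi : lvfield n) (eta : lform R n 1) (X : lvfield n) :
    lvfield n :=
  fun x => X x - eta x (X x) *: xi x.

(* For Y a section of D: nablaT_X Y = (nabla_X Y)^D for X in D, and
   nablaT_xi Y = [xi, Y]^D. *)
Definition nablaT {n} (xi : lvfield n) (eta : lform R n 1) (G : lendo n)
    (X Y : lvfield n) : lvfield n :=
  fun x => horiz xi eta (levi_civita G (horiz xi eta X) Y) x +
           eta x (X x) *: horiz xi eta (lie_bracket xi Y) x.

Definition curvT {n} (xi : lvfield n) (eta : lform R n 1) (G : lendo n)
    (X Y Z : lvfield n) : lvfield n :=
  fun x => nablaT xi eta G X (nablaT xi eta G Y Z) x
         - nablaT xi eta G Y (nablaT xi eta G X Z) x
         - nablaT xi eta G (lie_bracket X Y) Z x.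

(* Arguments are extended to constant vector fields (projected to D), which is
   harmless as the curvature is a tensor; the trace over D of an endomorphism
   of D is the trace over the tangent space of its extension by 0 on xi. *)
Definition horizc {n} (xi : lvfield n) (eta : lform R n 1) (u : 'rV[R]_n) :
    lvfield n :=
  horiz xi eta (fun=> u).

Definition ricciT {n} (xi : lvfield n) (eta : lform R n 1) (G : lendo n)
    (x : 'rV[R]_n) (u w : 'rV[R]_n) : R :=
  \sum_(k < n) curvT xi eta G (horizc xi eta (delta_mx 0 k))
                 (horizc xi eta u) (horizc xi eta w) x 0 k.

(* Chern-Weil representative of the first basic Chern class of (D, Phi):
   (i / 2 pi) tr_C (curvT), that is (1 / 4 pi) tr_R (Phi o curvT), as
   tr_C A = (tr_R A - i tr_R (Phi A)) / 2 and curvT is skew-symmetric. *)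
Definition chern1_form {n} (xi : lvfield n) (eta : lform R n 1)
    (Phi G : lendo n) : lform R n 2 :=
  fun x v => (4 * pi)^-1 *
    \tr ((\matrix_k curvT xi eta G (fun=> row 0 v) (fun=> row 1 v)
                      (horizc xi eta (delta_mx 0 k)) x) *m Phi x).

End Local.

Record manifold (R : realType) (n : nat) := Manifold {
  carrier :> topologicalType;
  chart : Type;
  dom : chart -> set carrier;
  coord : chart -> carrier -> 'rV[R]_n;
  param : chart -> 'rV[R]_n -> carrier;
  _ : hausdorff_space carrier;
  _ : @second_countable carrier;
  _ : forall p, exists i, dom i p;
  _ : forall i, open (dom i);
  _ : forall i, open (coord i @` dom i);
  _ : forall i p, dom i p -> {for p, continuous (coord i)};
  _ : forall i p, dom i p -> {for coord i p, continuous (param i)};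
  _ : forall i p, dom i p -> param i (coord i p) = p;
  _ : forall i j, smooth_on (coord i @` (dom i `&` dom j))
                            (coord j \o param i) }.

Section Tensors.
Context {R : realType} {n : nat} (M : manifold R n).

Definition cimg (i : chart M) : set 'rV[R]_n := coord i @` dom i.

(* Jacobian at the point p of the change of charts from i to j *)
Definition jac (i j : chart M) (p : M) : 'M[R]_n :=
  jacobian (coord j \o param i) (coord i p).

Definition vfield := chart M -> @lvfield R n.
Definition dform (L : Type) k := chart M -> @lform R L n k.
Definition endo := chart M -> @lendo R n.

Definition is_vfield (X : vfield) : Prop :=
  (forall i, smooth_on (cimg i) (X i)) /\
  (forall i j p, dom i p -> dom j p ->
     X j (coord j p) = X i (coord i p) *m jac i j p).

Definition is_form {k} (a : dform R k) : Prop :=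
  [/\ forall i v, smooth_on (cimg i) (fun x => a i x v : R^o),
      forall i x, cimg i x -> alternating (a i x)
    & forall i j p, dom i p -> dom j p -> forall v,
        a i (coord i p) v = a j (coord j p) (v *m jac i j p)].

Definition is_endo (F : endo) : Prop :=
  (forall i, smooth_on (cimg i) (F i)) /\
  (forall i j p, dom i p -> dom j p ->
     F i (coord i p) *m jac i j p = jac i j p *m F j (coord j p)).

Definition is_metric (g : endo) : Prop :=
  [/\ forall i, smooth_on (cimg i) (g i),
      forall i x, cimg i x -> posdef (g i x)
    & forall i j p, dom i p -> dom j p ->
        g i (coord i p) = jac i j p *m g j (coord j p) *m (jac i j p)^T].

Definition basic (xi : vfield) {k} (a : dform R k.+1) : Prop :=
  forall i x, cimg i x ->
    (forall w, contract (xi i x) (a i x) w = 0) /\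
    (forall v, lie_deriv (xi i) (a i) x v = 0).

Definition re_form {k} (a : dform R[i] k) : dform R k :=
  fun i x v => complex.Re (a i x v).
Definition im_form {k} (a : dform R[i] k) : dform R k :=
  fun i x v => complex.Im (a i x v).

End Tensors.

Section Contact.
Context {R : realType} (M : manifold R 7).

(* The factor 1/2 in [sas_metric]: the identity g = d eta o (1 (x) Phi) +
   eta (x) eta refers to the convention 2 d eta (X, Y) = X (eta Y) - Y (eta X) -
   eta [X, Y] of contact metric geometry; with the present evaluation of forms
   this d eta is half of [extd].  It is the normalisation for which the
   Kähler form of the cone is d (r^2 eta) / 2; without the factor no cone
   dr^2 + r^2 g would be Kähler for [cone_cpx]. *)
Record sasakian (xi : vfield M) (eta : dform M R 1) (Phi g : endo M) : Prop := {
  sas_xi : is_vfield xi;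
  sas_eta : is_form eta;
  sas_Phi : is_endo Phi;
  sas_g : is_metric g;
  sas_eta_xi : forall i x, cimg i x -> eta i x (xi i x) = 1;
  sas_Phi2 : forall i x, cimg i x -> forall u,
    u *m Phi i x *m Phi i x = - u + eta i x u *: xi i x;
  sas_contact : forall i x, cimg i x -> exists v : 'M[R]_7,
    let omega := extd (eta i) x in
    wedge (eta i x) (wedge (wedge omega omega) omega) v != 0;
  sas_compatible : forall i x, cimg i x -> forall u w,
    inner (g i x) (u *m Phi i x) (w *m Phi i x) =
    inner (g i x) u w - eta i x u * eta i x w;
  sas_metric : forall i x, cimg i x -> forall u w,
    inner (g i x) u w =
    2^-1 * extd (eta i) x (col_mx u (w *m Phi i x) : 'M[R]_(1 + 1, 7)) +
    eta i x u * eta i x w;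
  sas_cone : forall i,
    kahler_on (cone_dom (cimg i)) (cone_metric (g i))
              (cone_cpx (xi i) (eta i) (Phi i)) }.

(* The first basic Chern class vanishes: its Chern-Weil representative is the
   differential of a basic 1-form. *)
Definition basic_chern1_zero (xi : vfield M) (eta : dform M R 1)
    (Phi g : endo M) : Prop :=
  exists b : dform M R 1, [/\ is_form b, basic xi b &
    forall i x, cimg i x -> forall v,
      chern1_form (xi i) (eta i) (Phi i) (g i) x v = extd (b i) x v].

(* Type (k+1, 0) on D: a vanishes on each vector X + i Phi X of type (0,1),
   X in D. *)
Definition holomorphic_type (eta : dform M R 1) (Phi : endo M) {k}
    (a : dform M R[i] k.+1) : Prop :=
  forall i x, cimg i x -> forall u, eta i x u = 0 -> forall w,
    contract u (a i x) w + 'i%C * contract (u *m Phi i x) (a i x) w = 0.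

Record contact_calabi_yau (xi : vfield M) (eta : dform M R 1) (Phi g : endo M)
    (Ups : dform M R[i] 3) : Prop := {
  ccy_sasakian : sasakian xi eta Phi g;
  ccy_chern : basic_chern1_zero xi eta Phi g;
  ccy_re_form : is_form (re_form Ups);
  ccy_im_form : is_form (im_form Ups);
  ccy_nonvanishing : forall i x, cimg i x -> exists v, Ups i x v != 0;
  ccy_re_closed : forall i x, cimg i x -> forall v,
    extd (re_form Ups i) x v = 0;
  ccy_im_closed : forall i x, cimg i x -> forall v,
    extd (im_form Ups i) x v = 0;
  ccy_re_basic : basic xi (re_form Ups);
  ccy_im_basic : basic xi (im_form Ups);
  ccy_type : holomorphic_type eta Phi Ups }.

(* The restrictions to D of g and of omega (., Phi .) are proportional, hence
   have the same transverse Levi-Civita connection and Ricci tensor. *)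
Definition transverse_ricci_flat (xi : vfield M) (eta : dform M R 1)
    (g : endo M) : Prop :=
  forall i x, cimg i x -> forall u w,
    ricciT (xi i) (eta i) (g i) x u w = 0.

(* [nrm] is the function |Ups|_omega, where omega = d eta. *)
Definition is_Upsilon_norm (eta : dform M R 1) (Ups : dform M R[i] 3)
    (nrm : M -> R) : Prop :=
  (forall p, 0 < nrm p) /\
  (forall i p, dom i p -> forall v : 'M[R]_(6, 7),
     let x := coord i p in
     let omega := extd (eta i) x in
     (((3`!)%:R^-1 * wedge (wedge omega omega) omega v)%:C)%C =
     'i%C / 8 * ((nrm p ^+ 2)^-1)%:C%C *
       wedge (Ups i x) (fun w => conjc (Ups i x w)) v).


(* phi is a G2-structure with metric g and volume form vol; these are determined
   by phi. *)
Record G2_structure (phi : dform M R 3) (g : endo M) (vol : dform M R 7) :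
    Prop := {
  G2_form : is_form phi;
  G2_metric : is_metric g;
  G2_vol_form : is_form vol;
  G2_vol_unit : forall i x, cimg i x -> (vol i x 1%:M) ^+ 2 = \det (g i x);
  G2_compatible : forall i x, cimg i x -> forall (u w : 'rV[R]_7) (v : 'M[R]_7),
    wedge (wedge (contract u (phi i x)) (contract w (phi i x))) (phi i x) v =
    6 * inner (g i x) u w * vol i x v }.

Definition G2_dual (g : endo M) (vol : dform M R 7) (phi : dform M R 3) :
    dform M R 4 :=
  fun i x => star (g i x) (vol i x) (phi i x).

Definition tau0 (g : endo M) (vol : dform M R 7) (phi : dform M R 3)
    (i : chart M) (x : 'rV[R]_7) : R :=
  7^-1 * star (k := 7) (g i x) (vol i x)
           (wedge (phi i x) (extd (phi i) x)) (0 : 'M[R]_(0, 7)).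

(* phi_t, 0 <= t < T, is a family of G2-structures solving the flow; the time
   derivative at t = 0 is one-sided. *)
Definition modified_laplacian_coflow (A T : R) (phi : R -> dform M R 3) : Prop :=
  exists (g : R -> endo M) (vol : R -> dform M R 7),
    (forall t, 0 <= t < T -> G2_structure (phi t) (g t) (vol t)) /\
    let psi t := G2_dual (g t) (vol t) (phi t) in
    forall t, 0 <= t < T -> forall i x, cimg i x -> forall v,
      (fun s => (s - t)^-1 * (psi s i x v - psi t i x v))
        @ within [set s : R | 0 <= s < T] t^' -->
      hodge_laplacian (g t i) (vol t i) (psi t i) x v +
      extd (fun y w =>
              (A - 7 / 2 * tau0 (g t) (vol t) (phi t) i y) * phi t i y w) x v.

End Contact.

(* Main.v *)
(** At each point there is a coframe C in which eta, omega = d eta and Ups take the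
    standard form dx0, dx1 dx2 + dx3 dx4 + dx5 dx6 and
    (dx1 + i dx2)(dx3 + i dx4)(dx5 + i dx6): take a unitary frame of ker eta for the metric
    2 g, and rotate one of its vectors by the phase of Ups, whose modulus is 1 since
    |Ups| = 1.  Multiplying dx0 by a and the other covectors by b turns phi_t into the flat
    G2-structure, so that all pointwise identities become computations with forms with
    integer coefficients:
      g_t = a^2 eta^2 + b^2 (2 g - 2 eta^2),   vol_t = a b^6 eta omega^3 / 6,
      psi_t = b^4 omega^2 / 2 - a b^3 eta Im Ups,   *_t omega^2 = 2 a b^-2 eta omega.
    Hence, with d omega = 0 and d Ups = 0: d psi_t = 0, d phi_t = a b^2 omega^2,
    tau_0 = 6 a / (7 b^2), Delta psi_t = 2 a^2 omega^2, and the right-hand side of the flow is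
    - a^2 omega^2.  As a b^3 = eps is constant and d/dt (b^4 / 2) = - a^2, this is the time
    derivative of psi_t. *)
From Pilot Require Import Defs.
From mathcomp Require Import all_boot all_order all_algebra perm.
From mathcomp Require Import all_classical all_reals all_analysis.
From mathcomp.real_closed Require Import complex.
From mathcomp Require Import ring.

Set Implicit Arguments.
Unset Strict Implicit.
Unset Printing Implicit Defensive.

Import Order.TTheory GRing.Theory Num.Theory.
Import numFieldNormedType.Exports.
Import Pilot.Defs.

Local Open Scope classical_set_scope.
Local Open Scope ring_scope.

(** * Alternating forms and monomials *)

(** The adapted coframe exists at one point at a time, with no control on how it varies, so it
    serves only algebraic identities: wedge products, contractions and stars. Everything
    differential is done in chart coordinates on the tensors [eta], [g], [Phi] and [Ups], and
    [g2_metricE] removes the coframe from the metric again, which gives smoothness and the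
    transformation law. The two sides meet because d phi_t, d psi_t and the codifferential of psi_t
    stay combinations of eta, omega and Ups with coefficients constant on M. Forms being functions
    of matrices, the algebra is reduced to minors: an alternating form is a combination of
    monomials, a wedge of monomials concatenates index lists, and a star complements them.
    Identities of the model become equalities of lists with integer coefficients, decided by
    evaluation and transported along [v *m C]. The closedness of eta Im Ups rests on omega Im Ups =
    0, and that of omega on the Kähler cone. *)

Section Alternating.
Context {R : realType} {n : nat}.

Lemma alternating_comb k (a b : 'M[R]_(k, n) -> R) (c d : R) :
  alternating a -> alternating b -> alternating (fun v => c * a v + d * b v).
Proof.
move=> [la za] [lb zb]; split=> [A B C i s t AE jE|A i j ij AE].
- by rewrite (la A B C i s t)// (lb A B C i s t)//; ring.
- by rewrite (za A i j)// (zb A i j)//; ring.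
Qed.

Lemma alternatingZ k (a : 'M[R]_(k, n) -> R) c :
  alternating a -> alternating (fun v => c * a v).
Proof.
move=> [la za]; split=> [A B C i s t AE jE|A i j ij AE].
- by rewrite (la A B C i s t)//; ring.
- by rewrite (za A i j)// mulr0.
Qed.

Lemma alternating_sum k (I : Type) (r : seq I) (F : I -> 'M[R]_(k, n) -> R) :
  (forall i, alternating (F i)) ->
  alternating (fun v => \sum_(i <- r) F i v).
Proof.
move=> Falt; split=> [A B C i s t AE jE|A i j ij AE].
- rewrite !mulr_sumr -big_split/=; apply: eq_bigr => m _.
  exact: (Falt m).1 _ _ _ _ _ _ AE jE.
- by apply: big1 => m _; exact: (Falt m).2 _ _ _ ij AE.
Qed.

Lemma alternating_pullback k p (a : 'M[R]_(k, n) -> R) (C : 'M[R]_(p, n)) :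
  alternating a -> alternating (fun v => a (v *m C)).
Proof.
move=> [la za]; split=> [A B D i s t AE jE|A i j ij AE].
- apply: (la (A *m C) (B *m C) (D *m C) i) => [|j ji].
    by rewrite !row_mul AE mulmxDl !scalemxAl.
  by rewrite !row_mul; have [-> ->] := jE j ji.
- by apply: (za _ i j) => //; rewrite !row_mul AE.
Qed.

Lemma alternating_det (C : 'M[R]_n) : alternating (fun v => \det (v *m C)).
Proof.
have lift_neq (i : 'I_n) m : lift i m != i by rewrite eq_sym neq_lift.
apply: (@alternating_pullback n n (fun v => \det v)); split=> [A B D i s t AE jE|A i j ij AE].
- apply: (determinant_multilinear AE); apply/matrixP => m l; rewrite !mxE.
  + by have [/rowP/(_ l) + _] := jE (lift i m) (lift_neq i m); rewrite !mxE.
  + by have [_ /rowP/(_ l) +] := jE (lift i m) (lift_neq i m); rewrite !mxE.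
- by apply: (determinant_alternate ij) => m; move/rowP: AE => /(_ m); rewrite !mxE.
Qed.

Lemma contractDl k (a : 'M[R]_(1 + k, n) -> R) c d u w v : alternating a ->
  contract (c *: u + d *: w) a v = c * contract u a v + d * contract w a v.
Proof.
move=> [la _]; apply: (la _ _ _ (@lshift 1 k 0)).
- by rewrite !rowKu !row_id.
- move=> j; case: (split_ordP j) => j' ->; first by rewrite (ord1 j') eqxx.
  by rewrite !rowKd.
Qed.

Lemma contract0l k (a : 'M[R]_(1 + k, n) -> R) v : alternating a -> contract 0 a v = 0.
Proof.
by move=> aalt; have := contractDl 0 0 0 0 v aalt; rewrite !scale0r addr0 => ->; ring.
Qed.

Lemma contract_suml k (a : 'M[R]_(1 + k, n) -> R) (I : Type) (r : seq I)
    (c : I -> R) (u : I -> 'rV[R]_n) v : alternating a ->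
  contract (\sum_(i <- r) c i *: u i) a v = \sum_(i <- r) c i * contract (u i) a v.
Proof.
move=> aalt; elim: r => [|i r IH]; first by rewrite !big_nil contract0l.
by rewrite !big_cons -IH -[X in _ + X]scale1r contractDl// mul1r.
Qed.

Lemma alternating_contract k (a : 'M[R]_(1 + k, n) -> R) u :
  alternating a -> alternating (contract u a).
Proof.
move=> [la za]; split=> [A B C i s t AE jE|A i j ij AE].
- apply: (la _ _ _ (@rshift 1 k i)); first by rewrite !rowKd.
  move=> j; case: (split_ordP j) => j' ->; first by rewrite !rowKu.
  by rewrite (inj_eq (@rshift_inj _ _)) => /jE; rewrite !rowKd.
- apply: (za _ (@rshift 1 k i) (@rshift 1 k j)); last by rewrite !rowKd.
  by rewrite (inj_eq (@rshift_inj _ _)).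
Qed.

(** Expansion by multilinearity alone, hence over all [f], injective or not. The induction splits
    off the first row by contraction; [h] glues its index to the map for the remaining rows. *)
Lemma alternating_mulmx k p (a : 'M[R]_(k, n) -> R) (A : 'M[R]_(k, p))
    (C : 'M[R]_(p, n)) : alternating a ->
  a (A *m C) = \sum_(f : {ffun 'I_k -> 'I_p}) (\prod_i A i (f i)) * a (rowsub f C).
Proof.
elim: k => [|k IH] in a A *=> aalt.
  pose f0 : {ffun 'I_0 -> 'I_p} := ffun0 (card_ord 0).
  rewrite (bigD1 f0)//= [X in _ + X]big1 ?addr0; last first.
    by move=> f /negP[]; apply/eqP/ffunP => -[].
  by rewrite big_ord0 mul1r; congr a; apply/matrixP => -[].
have -> : a (A *m C) = contract (usubmx (A : 'M[R]_(1 + k, p)) *m C) a (dsubmx (A : 'M[R]_(1 + k, p)) *m C).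
  by rewrite /contract -mul_col_mx vsubmxK.
rewrite (mulmx_sum_row (usubmx _)) contract_suml//.
under eq_bigr => j _ do
  rewrite (IH (contract (row j C) a) _ (alternating_contract _ aalt)) mulr_sumr.
rewrite (pair_bigA _ (fun j f => _)) /=.
pose h (p0 : 'I_p * {ffun 'I_k -> 'I_p}) : {ffun 'I_k.+1 -> 'I_p} :=
  [ffun i => if unlift ord0 i is Some i' then p0.2 i' else p0.1].
rewrite (reindex h)/=; last first.
  exists (fun f => (f ord0, [ffun i => f (lift ord0 i)])) => [[j f] _|f _].
    congr (_, _); first by rewrite ffunE unlift_none.
    by apply/ffunP => i; rewrite !ffunE liftK.
  by apply/ffunP => i; rewrite ffunE; case: unliftP => [i'|] -> //=; rewrite ffunE.
apply: eq_bigr => -[j f] _ /=; rewrite big_ord_recl mulrA; congr (_ * _ * _).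
- by rewrite !mxE ffunE unlift_none; congr (A _ _); exact: val_inj.
- apply: eq_bigr => i _; rewrite !mxE ffunE liftK; congr (A _ _); exact: val_inj.
- congr (a _); apply/matrixP => i l; case: (@split_ordP 1 k i) => i' ->.
    etransitivity; first exact: (@col_mxEu R 1 k n (row j C) (rowsub f C) i' l).
    rewrite !mxE ffunE; case: unliftP => //= i0 /(congr1 val)/=.
    by rewrite (ord1 i').
  etransitivity; first exact: (@col_mxEd R 1 k n (row j C) (rowsub f C) i' l).
  rewrite !mxE ffunE; case: unliftP => /= [i0|] /(congr1 val)//= [].
  by move/val_inj ->.
Qed.

Lemma alternating_row_perm k (a : 'M[R]_(k, n) -> R) (s : 'S_k) v :
  alternating a -> a (row_perm s v) = (-1) ^+ s * a v.
Proof.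
move=> [la za].
have swap (i j : 'I_k) w : i != j -> a (row_perm (tperm i j) w) = - a w.
  move=> ij; have ji : j != i by rewrite eq_sym.
  (* [F x y] has [x] in row [i] and [y] in row [j]; polarising F (x + y) (x + y) = 0 gives the sign
     of a transposition. *)
  pose F x y := a (\matrix_m (if m == i then x else if m == j then y else row m w)).
  have FDl x y z : F (x + y) z = F x z + F y z.
    have := la (\matrix_m (if m == i then x + y else if m == j then z else row m w))
      (\matrix_m (if m == i then x else if m == j then z else row m w))
      (\matrix_m (if m == i then y else if m == j then z else row m w)) i 1 1.
    rewrite !mul1r; apply; first by rewrite !rowK eqxx !scale1r.
    by move=> m /negbTE mi; rewrite !rowK mi.
  have FDr x y z : F x (y + z) = F x y + F x z.
    have := la (\matrix_m (if m == i then x else if m == j then y + z else row m w))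
      (\matrix_m (if m == i then x else if m == j then y else row m w))
      (\matrix_m (if m == i then x else if m == j then z else row m w)) j 1 1.
    rewrite !mul1r; apply; first by rewrite !rowK (negbTE ji) eqxx !scale1r.
    by move=> m /negbTE mj; rewrite !rowK mj.
  have F0 x : F x x = 0 by apply: (za _ i j) => //; rewrite !rowK eqxx (negbTE ji) eqxx.
  have := F0 (row i w + row j w); rewrite FDl !FDr !F0 add0r addr0 => /eqP.
  rewrite addrC addr_eq0 => /eqP; rewrite /F => FE.
  transitivity (F (row j w) (row i w)).
    congr a; apply/matrixP => m l; rewrite !mxE; case: tpermP => [->|->|/eqP/negbTE mi /eqP/negbTE mj].
    - by rewrite eqxx !mxE.
    - by rewrite (negbTE ji) eqxx !mxE.
    - by rewrite mi mj !mxE.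
  rewrite [F _ _]FE; congr (- a _); apply/row_matrixP => m; rewrite rowK.
  by have [->//|_] := eqVneq m i; have [->|] := eqVneq m j.
have [ts -> _] := prod_tpermP s; elim: ts => [|t ts IH].
  by rewrite big_nil row_perm1 odd_perm1 mul1r.
rewrite big_cons row_permM; have [->|tt] := eqVneq t.1 t.2.
  by rewrite tperm1 row_perm1 mul1g IH.
by rewrite swap// IH odd_permM odd_tperm tt /= signrN mulNr.
Qed.

End Alternating.

(** * Wedge products of monomials *)

Section BlockPerm.
Variables k l : nat.

Definition block_perm_fun (p : 'S_k) (q : 'S_l) (i : 'I_(k + l)) : 'I_(k + l) :=
  match fintype.split i with inl a => lshift l (p a) | inr b => rshift k (q b) end.

Lemma block_perm_fun_inj p q : injective (block_perm_fun p q).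
Proof.
apply: (can_inj (g := block_perm_fun p^-1%g q^-1%g)) => i.
rewrite /block_perm_fun; case: (split_ordP i) => j ->.
  by rewrite (unsplitK (inl _)) permK.
by rewrite (unsplitK (inr _)) permK.
Qed.

Definition block_perm p q : 'S_(k + l) := perm (@block_perm_fun_inj p q).

Lemma block_perm_lshift p q i : block_perm p q (lshift l i) = lshift l (p i).
Proof. by rewrite permE /block_perm_fun (unsplitK (inl _)). Qed.

Lemma block_perm_rshift p q i : block_perm p q (rshift k i) = rshift k (q i).
Proof. by rewrite permE /block_perm_fun (unsplitK (inr _)). Qed.

(** The permutation matrix is block diagonal, so the sign is read off as a determinant. *)
Lemma sign_block_perm (R : comNzRingType) p q :
  (-1) ^+ block_perm p q = (-1) ^+ p * (-1) ^+ q :> R.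
Proof.
rewrite -!det_perm -(det_ublock _ 0); congr (\det _); apply/matrixP => i j.
rewrite !mxE; case: (split_ordP i) => i' ->; rewrite ?(block_perm_lshift, block_perm_rshift) ?(col_mxEu, col_mxEd);
  case: (split_ordP j) => j' ->; rewrite ?(row_mxEl, row_mxEr) !mxE.
- by rewrite (inj_eq (@lshift_inj _ _)).
- by rewrite eq_lrshift.
- by rewrite eq_rlshift.
- by rewrite (inj_eq (@rshift_inj _ _)).
Qed.

End BlockPerm.

Section Wedge.
Context {R : realType} {n : nat}.

Lemma wedge_suml (L : fieldType) k l (I : Type) (r : seq I) (c : I -> L)
    (F : I -> 'M[R]_(k, n) -> L) (b : 'M[R]_(l, n) -> L) v :
  wedge (fun w => \sum_(i <- r) c i * F i w) b v =
  \sum_(i <- r) c i * wedge (F i) b v.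
Proof.
rewrite /wedge; under [RHS]eq_bigr => i _ do rewrite mulrCA mulr_sumr.
rewrite -mulr_sumr exchange_big/=; congr (_ * _); apply: eq_bigr => s _.
rewrite mulr_sumr mulr_suml; apply: eq_bigr => i _.
by rewrite [_ * (c i * _)]mulrCA !mulrA.
Qed.

Lemma wedge_sumr (L : fieldType) k l (I : Type) (r : seq I) (c : I -> L)
    (a : 'M[R]_(k, n) -> L) (F : I -> 'M[R]_(l, n) -> L) v :
  wedge a (fun w => \sum_(i <- r) c i * F i w) v =
  \sum_(i <- r) c i * wedge a (F i) v.
Proof.
rewrite /wedge; under [RHS]eq_bigr => i _ do rewrite mulrCA mulr_sumr.
rewrite -mulr_sumr exchange_big/=; congr (_ * _); apply: eq_bigr => s _.
rewrite mulr_sumr; apply: eq_bigr => i _.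
by rewrite mulrCA.
Qed.

Lemma wedge_pullback (L : fieldType) k l p (a : 'M[R]_(k, n) -> L)
    (b : 'M[R]_(l, n) -> L) (C : 'M[R]_(p, n)) v :
  wedge a b (v *m C) = wedge (fun w => a (w *m C)) (fun w => b (w *m C)) v.
Proof.
rewrite /wedge; congr (_ * _); apply: eq_bigr => s _.
by rewrite (_ : row_perm s (v *m C) = row_perm s v *m C) ?mul_usub_mx ?mul_dsub_mx// !row_permE mulmxA.
Qed.

End Wedge.

Section Monomials.
Context {R : realType} {n : nat}.

(* The monomial dx_{I_0} /\ ... /\ dx_{I_{k-1}}; missing indices and indices above n are read as 0. *)
Definition mono k (I : seq nat) (v : 'M[R]_(k, n.+1)) : R :=
  \det (\matrix_(i < k, j < k) v i (inord (nth 0%N I j))).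

(** Selecting columns by a matrix product makes [mono] a pullback of the determinant, hence
    alternating. *)
Definition selmx k (I : seq nat) : 'M[R]_(n.+1, k) :=
  \matrix_(i, j) (i == inord (nth 0%N I j))%:R.

Lemma mono_selmx k I (v : 'M[R]_(k, n.+1)) : mono I v = \det (v *m selmx k I).
Proof.
congr (\det _); apply/matrixP => i j; rewrite !mxE.
rewrite (bigD1 (inord (nth 0%N I j)))//= mxE eqxx mulr1 big1 ?addr0// => m mj.
by rewrite mxE (negbTE mj) mulr0.
Qed.

Lemma alternating_mono k I : alternating (@mono k I).
Proof.
rewrite (_ : mono I = fun v => \det ((v *m selmx k I) *m 1%:M)).
  exact: (@alternating_pullback R k k n.+1 (fun w => \det (w *m 1%:M)) _ (alternating_det _)).
by apply/funext => v; rewrite mono_selmx mulmx1.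
Qed.

Lemma mono_sum_perm k I (v : 'M[R]_(k, n.+1)) :
  mono I v = \sum_(s : 'S_k) (-1) ^+ s * \prod_i v (s i) (inord (nth 0%N I i)).
Proof.
rewrite /mono -det_tr; apply: eq_bigr => s _; congr (_ * _).
by apply: eq_bigr => i _; rewrite !mxE.
Qed.

(** Expanding both minors over permutations yields the summands of the larger minor at the products
    of a block permutation with [s]. For a fixed block permutation the sum over [s] is the whole
    minor, which thus appears k! l! times; the normalisation of [wedge] cancels this. *)
Lemma wedge_mono k l I J (v : 'M[R]_(k + l, n.+1)) : size I = k ->
  wedge (@mono k I) (@mono l J) v = mono (I ++ J) v.
Proof.
move=> sI; rewrite [RHS]mono_sum_perm.
pose G (u : 'S_(k + l)) := (-1) ^+ u *
  ((\prod_(i < k) v (u (lshift l i)) (inord (nth 0%N I i))) *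
   (\prod_(j < l) v (u (rshift k j)) (inord (nth 0%N J j)))).
transitivity (\sum_(u : 'S_(k + l)) G u); last first.
  apply: eq_bigr => u _; congr (_ * _); rewrite big_split_ord/=; congr (_ * _).
    by apply: eq_bigr => i _; rewrite nth_cat sI ltn_ord.
  by apply: eq_bigr => i _; rewrite nth_cat sI ltnNge leq_addr/= addKn.
have E (s : 'S_(k + l)) : (-1) ^+ s * mono I (usubmx (row_perm s v)) * mono J (dsubmx (row_perm s v))
    = \sum_(p : 'S_k) \sum_(q : 'S_l) G (block_perm p q * s)%g.
  rewrite !mono_sum_perm -mulrA big_distrlr/= mulr_sumr; apply: eq_bigr => p _.
  rewrite mulr_sumr; apply: eq_bigr => q _.
  rewrite /G odd_permM signr_addb sign_block_perm.
  under [X in _ = _ * (X * _)]eq_bigr do rewrite permM block_perm_lshift.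
  under [X in _ = _ * (_ * X)]eq_bigr do rewrite permM block_perm_rshift.
  under [X in _ * (_ * X * _) = _]eq_bigr do rewrite !mxE.
  under [X in _ * (_ * (_ * X)) = _]eq_bigr do rewrite !mxE.
  by rewrite [X in _ * X]mulrACA [LHS]mulrA; congr (_ * _); rewrite mulrC.
rewrite /wedge; under eq_bigr do rewrite E.
rewrite exchange_big/=; under eq_bigr do rewrite exchange_big/=.
have reG p q : \sum_u G (block_perm p q * u)%g = \sum_u G u.
  by rewrite [RHS](reindex_inj (mulgI (block_perm p q))).
under eq_bigr do under eq_bigr do rewrite reG.
rewrite !sumr_const !card_Sn -mulrnA -[X in _ * X]mulr_natl mulrA mulnC mulVf ?mul1r//.
Qed.

Definition seqf k (f : 'I_k -> 'I_n.+1) : seq nat := [seq val (f i) | i <- enum 'I_k].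

Lemma size_seqf k (f : 'I_k -> 'I_n.+1) : size (seqf f) = k.
Proof. by rewrite size_map size_enum_ord. Qed.

Lemma nth_seqf k (f : 'I_k -> 'I_n.+1) (i : 'I_k) : nth 0%N (seqf f) i = f i.
Proof. by rewrite (nth_map i) ?size_enum_ord// nth_ord_enum. Qed.

(** Taking all maps [f] with weight 1/k! avoids increasing multi-indices: expanding each minor over
    permutations turns the right side into k! reindexed copies of the basis expansion of [a v]. *)
Lemma alternating_mono_sum k (a : 'M[R]_(k, n.+1) -> R) v : alternating a ->
  a v = \sum_(f : {ffun 'I_k -> 'I_n.+1})
    ((k`!)%:R^-1 * a (rowsub f 1%:M)) * mono (seqf f) v.
Proof.
move=> aalt; under eq_bigr do rewrite -mulrA; rewrite -mulr_sumr.
pose G (f : {ffun 'I_k -> 'I_n.+1}) := (\prod_i v i (f i)) * a (rowsub f 1%:M).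
have aE : a v = \sum_f G f by rewrite -[v in LHS]mulmx1 alternating_mulmx.
pose sh (s : 'S_k) (f : {ffun 'I_k -> 'I_n.+1}) := [ffun i => f (s i)].
have sh_inj s : injective (sh s).
  by move=> f g /ffunP fg; apply/ffunP => i; have := fg (s^-1%g i); rewrite !ffunE permKV.
have E (f : {ffun 'I_k -> 'I_n.+1}) : a (rowsub f 1%:M) * mono (seqf f) v = \sum_(s : 'S_k) G (sh s f).
  rewrite mono_sum_perm mulr_sumr (reindex_inj (@invg_inj 'S_k))/=; apply: eq_bigr => s _.
  rewrite /G (_ : rowsub (sh s f) _ = row_perm s (rowsub f 1%:M)); last first.
    by apply/matrixP => i j; rewrite !mxE ffunE.
  rewrite alternating_row_perm// odd_permV mulrCA [RHS]mulrC -[RHS]mulrA; congr (_ * (_ * _)).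
  rewrite (reindex_inj (@perm_inj _ s)); apply: eq_bigr => i _.
  by rewrite permK nth_seqf inord_val ffunE.
under eq_bigr do rewrite E.
rewrite exchange_big/=; have reG s : \sum_f G (sh s f) = a v by rewrite aE [RHS](reindex_inj (@sh_inj s)).
under eq_bigr do rewrite reG.
rewrite sumr_const card_Sn -[a v *+ _]mulr_natl mulrA mulVf ?mul1r//.
Qed.

End Monomials.

(** * Exterior derivative *)

Section MonoSwap.
Context {R : realType} {n : nat}.

(** The bound places both exchanged columns inside the minor, as [mono] reads only the first [k]
    entries of its list. *)
Lemma mono_swap k P x y S (v : 'M[R]_(k, n.+1)) : ((size P).+1 < k)%N ->
  mono (P ++ x :: y :: S) v = - mono (P ++ y :: x :: S) v.
Proof.
move=> Pk; pose a := Ordinal (ltnW Pk); pose b := Ordinal Pk.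
have ab : a != b by rewrite -val_eqE/= neq_ltn leqnn.
rewrite /mono; set B := (\matrix_(i, j) _ in RHS).
transitivity (\det (col_perm (tperm a b) B)); last first.
  by rewrite col_permE det_mulmx det_perm odd_permV odd_tperm ab expr1 mulrN1.
congr (\det _); apply/matrixP => i j; rewrite !mxE; congr (v i (inord _)).
case: tpermP => [->|->|/eqP ja /eqP jb].
- by rewrite !nth_cat/= ltnn ltnNge leqnSn/= subnn subSnn.
- by rewrite !nth_cat/= ltnn ltnNge leqnSn/= subnn subSnn.
- rewrite !nth_cat; case: ltnP => // Pj.
  have Pj2 : ((size P).+1 < j)%N.
    by rewrite ltn_neqAle eq_sym jb ltn_neqAle eq_sym ja.
  by case E : (j - size P)%N => [|[|m]] //; move: Pj2; rewrite -subn_gt0 subnS E.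
Qed.

Lemma mono_shift k P x S T (v : 'M[R]_(k, n.+1)) : (size P + size S < k)%N ->
  mono (P ++ x :: S ++ T) v = (-1) ^+ size S * mono (P ++ S ++ x :: T) v.
Proof.
elim: S P => [|y S IH] P sP /=; first by rewrite mul1r.
rewrite mono_swap; last by apply: leq_ltn_trans sP; rewrite /= addnS ltnS leq_addr.
have /= := IH (rcons P y); rewrite !cat_rcons => ->; first by rewrite exprS mulN1r mulNr.
by rewrite size_rcons addSnnS.
Qed.

Lemma mono_uniq k P x S T (v : 'M[R]_(k, n.+1)) : ((size P + size S).+1 < k)%N ->
  mono (P ++ x :: S ++ x :: T) v = 0.
Proof.
move=> sP; rewrite mono_shift; last exact: ltnW.
have := @mono_swap k (P ++ S) x x T v; rewrite size_cat -catA => /(_ sP) E.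
have {E} : mono (P ++ S ++ x :: x :: T) v *+ 2 = 0 by rewrite mulr2n {1}E addNr.
by move/eqP; rewrite mulrn_eq0/= => /eqP ->; rewrite mulr0.
Qed.

End MonoSwap.

Section Exterior.
Context {R : realType}.

Lemma near_open n (U : set 'rV[R]_n) x (P : 'rV[R]_n -> Prop) :
  open U -> U x -> (forall y, U y -> P y) -> \forall y \near x, P y.
Proof. by move=> oU Ux UP; apply: filterS UP _; exact: open_nbhs_nbhs. Qed.

(** Locality of d. Coordinate expressions are constrained only on the open image of a chart, so
    equalities there must suffice for differentiation. *)
Lemma eq_extd n k (U : set 'rV[R]_n) (a b : lform R n k) x v : open U -> U x ->
  (forall y, U y -> forall w, a y w = b y w) -> extd a x v = extd b x v.
Proof.
move=> oU Ux ab; rewrite /extd; apply: eq_bigr => j _; congr (_ * _).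
by apply: near_eq_derive; apply: (near_open oU Ux) => y /ab.
Qed.

Lemma extd0 n k x v : extd ((fun _ _ => 0) : lform R n k) x v = 0.
Proof.
by rewrite /extd big1// => j _; rewrite (derive_cst (0 : R^o)) mulr0.
Qed.

Lemma derive_sum_coord n (f : 'rV[R]_n -> R^o) x w : differentiable f x ->
  'D_w f x = \sum_(i < n) w 0 i * 'D_(delta_mx 0 i) f x.
Proof.
move=> df; rewrite deriveE// {1}(row_sum_delta w) linear_sum.
by apply: eq_bigr => i _; rewrite linearZ/= -deriveE.
Qed.

Lemma extd_comb n k (a b : lform R n k) (c d : R) x v :
  (forall w, differentiable (fun y => a y w : R^o) x) ->
  (forall w, differentiable (fun y => b y w : R^o) x) ->
  extd (fun y w => c * a y w + d * b y w) x v = c * extd a x v + d * extd b x v.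
Proof.
move=> da db; rewrite /extd !mulr_sumr -big_split/=; apply: eq_bigr => j _.
rewrite (_ : 'D_(row j v) _ x = c * 'D_(row j v) (fun y => a y (row' j v)) x + d * 'D_(row j v) (fun y => b y (row' j v)) x); first by ring.
have dva := diff_derivable (v := row j v) (da (row' j v)).
have dvb := diff_derivable (v := row j v) (db (row' j v)).
have dca := derivableZ (k := c) dva; have ddb := derivableZ (k := d) dvb.
by have := deriveD dca ddb; rewrite (deriveZ c dva) (deriveZ d dvb).
Qed.

Lemma extdZ n k (a : lform R n k) c x v :
  (forall w, differentiable (fun y => a y w : R^o) x) ->
  extd (fun y w => c * a y w) x v = c * extd a x v.
Proof.
move=> da; have := extd_comb c 0 v da da; rewrite mul0r addr0 => <-.
by congr extd; apply/funext => y; apply/funext => w; rewrite mul0r addr0.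
Qed.

Lemma extd_sum n k (I : Type) (r : seq I) (F : I -> lform R n k) x v :
  (forall i w, differentiable (fun y => F i y w : R^o) x) ->
  extd (fun y w => \sum_(i <- r) F i y w) x v = \sum_(i <- r) extd (F i) x v.
Proof.
move=> dF; elim: r => [|i r IH].
  rewrite big_nil -[RHS](@extd0 n k x v); congr extd.
  by apply/funext => y; apply/funext => w; rewrite big_nil.
rewrite big_cons -IH -[extd (F i) _ _]mul1r -[X in _ + X]mul1r -extd_comb//.
  congr extd; apply/funext => y; apply/funext => w.
  by rewrite big_cons !mul1r.
move=> w; elim: r {IH} => [|j r IH].
  by rewrite (_ : (fun _ => _) = cst 0)//; apply/funext => y; rewrite big_nil.
rewrite (_ : (fun _ => _) = (fun y => F j y w : R^o) + (fun y => \sum_(i <- r) F i y w)).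
  exact: differentiableD.
by apply/funext => y; rewrite big_cons.
Qed.

(** The alternating sum in [extd] is the cofactor expansion of the minor for [val i :: I] along its
    first column. *)
Lemma extd_mono n k (f : 'rV[R]_n.+1 -> R^o) I x (v : 'M[R]_(k.+1, n.+1)) :
  differentiable f x ->
  extd (fun y (w : 'M[R]_(k, n.+1)) => f y * mono I w) x v =
  \sum_(i < n.+1) 'D_(delta_mx 0 i) f x * mono (val i :: I) v.
Proof.
move=> df; rewrite /extd.
have E (j : 'I_k.+1) : (-1) ^+ j * 'D_(row j v) (fun y => f y * mono I (row' j v)) x =
  \sum_(i < n.+1) 'D_(delta_mx 0 i) f x * (v j i * ((-1) ^+ j * mono I (row' j v))).
  rewrite (_ : (fun y => f y * mono I (row' j v)) = mono I (row' j v) \*: f); last first.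
    by apply/funext => y; rewrite mulrC.
  rewrite deriveZ; last exact: diff_derivable.
  rewrite derive_sum_coord// scaler_sumr mulr_sumr; apply: eq_bigr => i _.
  by rewrite !mxE /GRing.scale/=; ring.
under eq_bigr do rewrite E.
rewrite exchange_big/=; apply: eq_bigr => i _; rewrite -mulr_sumr; congr (_ * _).
rewrite {2}/mono (expand_det_col _ ord0); apply: eq_bigr => j _.
rewrite !mxE/= inord_val; congr (_ * _); rewrite /cofactor addn0; congr (_ * _).
by congr (\det _); apply/matrixP => p q; rewrite !mxE.
Qed.

End Exterior.

Section Leibniz.
Context {R : realType} {n : nat}.

(** Prefixing [S] is wedging with dx_S from the left, which preserves vanishing. The degree [m] is a
    variable because k + l.+1 and (k + l).+1 are not convertible. *)
Lemma mono_cat_eq0 k l m (I : finType) (c : I -> R) (J : I -> seq nat) (S : seq nat)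
    (v : 'M[R]_(m, n.+1)) : m = (k + l)%N -> size S = k ->
  (forall w : 'M[R]_(l, n.+1), \sum_i c i * mono (J i) w = 0) ->
  \sum_i c i * mono (S ++ J i) v = 0.
Proof.
move=> mE sS J0; subst m.
under eq_bigr do rewrite -wedge_mono//.
rewrite -wedge_sumr /wedge big1 ?mulr0// => s _.
by rewrite J0 mulr0.
Qed.

Definition coef k (a : lform R n.+1 k) (f : {ffun 'I_k -> 'I_n.+1}) : 'rV[R]_n.+1 -> R^o :=
  fun y => (k`!)%:R^-1 * a y (rowsub f 1%:M).

Variables (U : set 'rV[R]_n.+1) (x : 'rV[R]_n.+1).
Hypotheses (oU : open U) (Ux : U x).

Lemma differentiable_coef k (a : lform R n.+1 k) f :
  (forall w, differentiable (fun y => a y w : R^o) x) -> differentiable (coef a f) x.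
Proof. by move=> da; apply: differentiableZ; exact: da. Qed.

Lemma extd_coef k (a : lform R n.+1 k) v :
  (forall y, U y -> alternating (a y)) ->
  (forall w, differentiable (fun y => a y w : R^o) x) ->
  extd a x v = \sum_f \sum_(i < n.+1) 'D_(delta_mx 0 i) (coef a f) x * mono (val i :: seqf f) v.
Proof.
move=> aalt da.
rewrite (eq_extd (b := fun y w => \sum_f coef a f y * mono (seqf f) w) _ oU Ux); last first.
  by move=> y Uy w; rewrite [LHS]alternating_mono_sum//; exact: aalt.
rewrite extd_sum; last first.
  move=> f w; rewrite (_ : (fun _ => _) = (mono (seqf f) w) \*: coef a f).
    by apply: differentiableZ; exact: differentiable_coef.
  by apply/funext => y; rewrite mulrC.
by apply: eq_bigr => f _; rewrite extd_mono//; exact: differentiable_coef.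
Qed.

(** Leibniz rule without its signed term: that term has degree k + l.+1, which would need a cast,
    and the second factors that occur, omega and Im Ups, are closed. *)
Lemma extd_wedge_closed k l (a : lform R n.+1 k) (b : lform R n.+1 l) v :
  (forall y, U y -> alternating (a y)) -> (forall y, U y -> alternating (b y)) ->
  (forall w, differentiable (fun y => a y w : R^o) x) ->
  (forall w, differentiable (fun y => b y w : R^o) x) ->
  (forall w, extd b x w = 0) ->
  extd (fun y => wedge (a y) (b y)) x v = wedge (extd a x) (b x) v.
Proof.
move=> aalt balt da db b0.
have aE y : U y -> a y = fun w => \sum_f coef a f y * mono (seqf f) w.
  by move=> Uy; apply/funext => w; rewrite [LHS]alternating_mono_sum//; exact: aalt.
have bE y : U y -> b y = fun w => \sum_f coef b f y * mono (seqf f) w.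
  by move=> Uy; apply/funext => w; rewrite [LHS]alternating_mono_sum//; exact: balt.
pose G f g : lform R n.+1 (k + l) := fun y w => coef a f y * coef b g y * mono (seqf f ++ seqf g) w.
have dcc f g : differentiable (fun y => coef a f y * coef b g y : R^o) x.
  by apply: differentiableM; exact: differentiable_coef.
have dG f g w : differentiable (fun y => G f g y w : R^o) x.
  rewrite (_ : (fun _ => _) = (mono (seqf f ++ seqf g) w) \*: (fun y => coef a f y * coef b g y : R^o)).
    by apply: differentiableZ; exact: dcc.
  by apply/funext => y; rewrite /G mulrC.
rewrite (eq_extd (b := fun y w => \sum_(p : {ffun 'I_k -> 'I_n.+1} * {ffun 'I_l -> 'I_n.+1}) G p.1 p.2 y w) _ oU Ux); last first.
  move=> y Uy w; rewrite aE// bE// wedge_suml -(pair_bigA _ (fun f g => G f g y w))/=.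
  apply: eq_bigr => f _; rewrite wedge_sumr mulr_sumr; apply: eq_bigr => g _.
  by rewrite wedge_mono ?size_seqf// mulrA.
rewrite extd_sum//.
have E f g : extd (G f g) x v =
    \sum_(i < n.+1) 'D_(delta_mx 0 i) (coef a f) x * coef b g x * mono (val i :: seqf f ++ seqf g) v
  + \sum_(i < n.+1) coef a f x * 'D_(delta_mx 0 i) (coef b g) x * mono (val i :: seqf f ++ seqf g) v.
  rewrite extd_mono// -big_split/=; apply: eq_bigr => i _; rewrite -mulrDl; congr (_ * _).
  have ca := diff_derivable (v := delta_mx 0 i) (differentiable_coef f da).
  have cb := diff_derivable (v := delta_mx 0 i) (differentiable_coef g db).
  by have := deriveM ca cb; rewrite /GRing.scale/= => ->; rewrite addrC mulrC.
under eq_bigr do rewrite E.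
(* In the terms differentiating [b], dx_i moves past the k factors of dx_f; what remains is dx_f
   wedged with [extd b x], which is 0. *)
rewrite big_split/= [X in _ + X](_ : _ = 0) ?addr0; last first.
  rewrite -(pair_bigA _ (fun f g => \sum_(i < n.+1) coef a f x * 'D_(delta_mx 0 i) (coef b g) x * mono (val i :: seqf f ++ seqf g) v)).
  apply: big1 => f _ /=; rewrite pair_bigA/=.
  under eq_bigr => p _ do rewrite -mulrA -[_ :: _]cat0s mono_shift ?size_seqf ?addSn ?ltnS ?leq_addr//=.
  rewrite -mulr_sumr; under eq_bigr do rewrite mulrCA; rewrite -mulr_sumr.
  rewrite (mono_cat_eq0 (k := k) (l := l.+1)) ?mulr0 ?addnS ?size_seqf// => w.
  have := b0 w; rewrite extd_coef// pair_bigA/=; exact.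
rewrite [in RHS]bE// wedge_sumr -(pair_bigA _ (fun f g => \sum_(i < n.+1) 'D_(delta_mx 0 i) (coef a f) x * coef b g x * mono (val i :: seqf f ++ seqf g) v))/=.
rewrite exchange_big/=; apply: eq_bigr => g _.
rewrite (_ : extd a x = fun w => \sum_(p : {ffun 'I_k -> 'I_n.+1} * 'I_n.+1)
    'D_(delta_mx 0 p.2) (coef a p.1) x * mono (val p.2 :: seqf p.1) w); last first.
  by apply/funext => w; rewrite extd_coef// pair_bigA.
rewrite wedge_suml pair_bigA/= mulr_sumr; apply: eq_bigr => p _.
by rewrite wedge_mono/= ?size_seqf// mulrA [coef b g x * _]mulrC.
Qed.

End Leibniz.

(** * Computing with forms with integer coefficients *)

Section SparseForms.

Fixpoint insert_sign (x : nat) (I : seq nat) : option (bool * seq nat) :=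
  if I is y :: I' then
    if (x < y)%N then Some (false, x :: I)
    else if x == y then None
    else if insert_sign x I' is Some (b, J) then Some (~~ b, y :: J) else None
  else Some (false, [:: x]).

(* [None] stands for a repeated index; the boolean is the parity of the sorting permutation. *)
Fixpoint sort_sign (I : seq nat) : option (bool * seq nat) :=
  if I is x :: I' then
    if sort_sign I' is Some (b, J) then
      if insert_sign x J is Some (b', J') then Some (b (+) b', J') else None
    else None
  else Some (false, [::]).

Definition sparse := seq (int * seq nat).

Definition signz (b : bool) (c : int) : int := if b then - c else c.

Fixpoint add_term (c : int) (J : seq nat) (s : sparse) : sparse :=
  if s is p :: s' then
    if p.2 == J then (c + p.1, J) :: s' else p :: add_term c J s'
  else [:: (c, J)].

Definition normal (s : sparse) : sparse :=
  foldr (fun p t => if sort_sign p.2 is Some (b, J) then add_term (signz b p.1) J t else t) [::] s.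

Definition degree (k : nat) (s : sparse) := all (fun p => size p.2 == k) s.

Definition scale (c : int) (s : sparse) : sparse := [seq (c * p.1, p.2) | p <- s].

(** Equality test: the difference is brought to sorted monomials with collected coefficients, all of
    which must be 0. The degree checks make sorting legitimate, since [mono] would ignore indices
    beyond the first [k]. *)
Definition same (k : nat) (s t : sparse) :=
  [&& degree k s, degree k t & all (fun p => p.1 == 0) (normal (s ++ scale (-1) t))].

Definition swedge (s t : sparse) : sparse :=
  flatten [seq [seq (p.1 * q.1, p.2 ++ q.2) | q <- t] | p <- s].

(** Interior product with the [i]-th basis vector. *)
Definition scontract (i : nat) (s : sparse) : sparse :=
  flatten [seq [seq (signz (odd j) p.1, take j p.2 ++ drop j.+1 p.2)
               | j <- iota 0 (size p.2) & nth 0%N p.2 j == i] | p <- s].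

Definition compl m (I : seq nat) := [seq i <- iota 0 m | i \notin I].

(** Hodge star of the standard orthonormal coframe and orientation; the sign is that of the
    permutation formed by the indices and their complement. The value at a repeated index is a
    default, excluded by [starrable]. *)
Definition sstar m (s : sparse) : sparse :=
  [seq (if sort_sign (p.2 ++ compl m p.2) is Some (true, _) then - p.1 else p.1, compl m p.2) | p <- s].

Definition starrable m k (s : sparse) :=
  all (fun p => [&& size p.2 == k, size (compl m p.2) == (m - k)%N,
    uniq (p.2 ++ compl m p.2), all (fun i => i < m)%N (p.2 ++ compl m p.2) &
    if sort_sign (p.2 ++ compl m p.2) is Some (_, J) then J == iota 0 m else false]) s.

End SparseForms.

Section Evaluation.
Context {R : realType} {n : nat}.

Definition ev k (s : sparse) (v : 'M[R]_(k, n.+1)) : R :=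
  \sum_(p <- s) p.1%:~R * mono p.2 v.

Lemma ev_cat k s t (v : 'M[R]_(k, n.+1)) : ev (s ++ t) v = ev s v + ev t v.
Proof. by rewrite /ev big_cat. Qed.

Lemma ev_cons k p t (v : 'M[R]_(k, n.+1)) : ev (p :: t) v = p.1%:~R * mono p.2 v + ev t v.
Proof. by rewrite /ev big_cons. Qed.

Lemma ev_nil k (v : 'M[R]_(k, n.+1)) : ev [::] v = 0.
Proof. by rewrite /ev big_nil. Qed.

Lemma ev_flatten k (ss : seq sparse) (v : 'M[R]_(k, n.+1)) :
  ev (flatten ss) v = \sum_(s <- ss) ev s v.
Proof. by elim: ss => [|s ss IH]; rewrite ?big_nil ?ev_nil//= big_cons ev_cat IH. Qed.

Lemma ev_scale k c s (v : 'M[R]_(k, n.+1)) : ev (scale c s) v = c%:~R * ev s v.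
Proof.
rewrite /ev /scale big_map mulr_sumr; apply: eq_bigr => p _.
by rewrite intrM mulrA.
Qed.

Lemma alternating_ev k s : alternating (@ev k s).
Proof.
apply: (@alternating_sum R n.+1 k _ s (fun p v => p.1%:~R * mono p.2 v)) => p.
exact/alternatingZ/alternating_mono.
Qed.

Lemma signzE b c : (signz b c)%:~R = (-1) ^+ b * c%:~R :> R.
Proof. by case: b => /=; rewrite ?mul1r// mulrNz mulN1r. Qed.

(** [P] holds the indices already passed, so that the induction can work in the middle of a
    minor. *)
Lemma mono_insert k P x I (v : 'M[R]_(k, n.+1)) : (size P + size I < k)%N ->
  mono (P ++ x :: I) v =
  if insert_sign x I is Some (b, J) then (-1) ^+ b * mono (P ++ J) v else 0.
Proof.
elim: I P => [|y I IH] P /= sP; first by rewrite mul1r.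
case: ltnP => [_|_]; first by rewrite mul1r.
have sP' : ((size P).+1 < k)%N by apply: leq_ltn_trans sP; rewrite addnS ltnS leq_addr.
case: eqP => [->|_].
  by rewrite (@mono_uniq _ _ _ P y [::] I) ?addn0.
rewrite mono_swap// -cat_rcons IH ?size_rcons ?addSnnS//.
case: (insert_sign x I) => [[b J]|]; last by rewrite oppr0.
by rewrite cat_rcons signrN mulNr.
Qed.

Lemma mono_sort k P I (v : 'M[R]_(k, n.+1)) : (size P + size I <= k)%N ->
  mono (P ++ I) v =
  if sort_sign I is Some (b, J) then (-1) ^+ b * mono (P ++ J) v else 0.
Proof.
have sizei x J b J' : insert_sign x J = Some (b, J') -> size J' = (size J).+1.
  elim: J b J' => [|y J IH] b J' /=; first by case=> _ <-.
  case: ltnP => _; first by case=> _ <-.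
  case: eqP => // _; case E : insert_sign => [[b0 J0]|]// [_ <-]/=.
  by rewrite (IH _ _ E).
have sizes J b J' : sort_sign J = Some (b, J') -> size J' = size J.
  elim: J b J' => [|y J IH] b J' /=; first by case=> _ <-.
  case E : sort_sign => [[b0 J0]|]//; case F : insert_sign => [[b1 J1]|]// [_ <-].
  by rewrite (sizei _ _ _ _ F) (IH _ _ E).
elim: I P => [|x I IH] P /= sP; first by rewrite mul1r.
rewrite -cat_rcons IH ?size_rcons ?addSnnS//.
case E : sort_sign => [[b J]|]//; rewrite cat_rcons mono_insert ?(sizes _ _ _ E) -?addnS//.
case: insert_sign => [[b' J']|]; last by rewrite mulr0.
by rewrite mulrA signr_addb.
Qed.

Lemma ev_add_term k c J s (v : 'M[R]_(k, n.+1)) :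
  ev (add_term c J s) v = c%:~R * mono J v + ev s v.
Proof.
elim: s => [|p s IH] /=; first by rewrite ev_cons.
case: eqP => [<-|_]; first by rewrite !ev_cons/= intrD mulrDl addrA.
by rewrite !ev_cons IH addrCA.
Qed.

Lemma ev_normal k s (v : 'M[R]_(k, n.+1)) : degree k s -> ev (normal s) v = ev s v.
Proof.
elim: s => [|p s IH]//= /andP[/eqP ps /IH {}IH]; rewrite ev_cons.
rewrite -[p.2]cat0s mono_sort ?ps//.
case: sort_sign => [[b J]|]; last by rewrite mulr0 add0r IH.
by rewrite ev_add_term IH signzE -!mulrA mulrCA.
Qed.

(** Soundness of the test: it turns each evaluation in the flat model into an identity of forms over
    [R]. *)
Lemma ev_same k s t (v : 'M[R]_(k, n.+1)) : same k s t -> ev s v = ev t v.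
Proof.
move=> /and3P[ds dt z]; apply/eqP; rewrite -subr_eq0 -[- _]mulN1r -[-1](mulrNz 1 1) -ev_scale -ev_cat.
rewrite -ev_normal; last first.
  by rewrite /degree all_cat; apply/andP; split=> //; rewrite all_map.
elim: (normal _) z => [|p u IH]; first by rewrite ev_nil.
by move=> /= /andP[/eqP p0 /IH]; rewrite ev_cons p0 mul0r add0r.
Qed.

Lemma ev_wedge k l s t (v : 'M[R]_(k + l, n.+1)) : degree k s ->
  wedge (@ev k s) (@ev l t) v = ev (swedge s t) v.
Proof.
move=> ds; rewrite /ev wedge_suml -/(ev _ _) ev_flatten big_map.
rewrite big_seq [RHS]big_seq; apply: eq_bigr => p ps.
rewrite wedge_sumr mulr_sumr /ev big_map; apply: eq_bigr => q _.
by rewrite wedge_mono ?intrM ?mulrA//; exact/eqP/(allP ds).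
Qed.

(** Cofactor expansion along the first row, which is the inserted argument. *)
Lemma contract_mono k u I (v : 'M[R]_(k, n.+1)) : size I = k.+1 ->
  contract u (@mono R n k.+1 I) v =
  \sum_(j < k.+1) (-1) ^+ j * u 0 (inord (nth 0%N I j)) * mono (take j I ++ drop j.+1 I) v.
Proof.
move=> sI; rewrite /contract /mono (expand_det_row _ ord0); apply: eq_bigr => j _.
rewrite !mxE/= /cofactor add0n mulrCA mulrA; congr (_ * _ * _).
  by case: split_ordP => [i' _|i' /(congr1 val)//]; rewrite (ord1 i').
congr (\det _); apply/matrixP => p q; rewrite !mxE.
case: split_ordP => [i' /(congr1 val)/=|i' /(congr1 val)/= [/val_inj <-]].
  by rewrite (ord1 i').
congr (v p (inord _)); rewrite nth_cat size_take sI ltn_ord /bump leqNgt.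
case: ltnP => qj; first by rewrite nth_take.
by rewrite nth_drop add1n addSn subnKC.
Qed.

Lemma contract_ev k (u : 'rV_n.+1) s (v : 'M[R]_(k, n.+1)) :
  degree k.+1 s -> all (fun p => all (fun i => i <= n)%N p.2) s ->
  contract u (@ev k.+1 s) v = \sum_(i < n.+1) u 0 i * ev (scontract i s) v.
Proof.
move=> ds bs; under eq_bigr do rewrite ev_flatten big_map mulr_sumr.
rewrite exchange_big/= {1}/contract {1}/ev big_seq [RHS]big_seq.
apply: eq_bigr => p ps; have sp : size p.2 = k.+1 by exact/eqP/(allP ds).
have := @contract_mono k u p.2 v sp; rewrite /contract => ->.
under [RHS]eq_bigr do rewrite /ev big_map big_filter sp -[k.+1]subn0 -/(index_iota _ _) big_mkcond big_mkord mulr_sumr.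
rewrite exchange_big/= mulr_sumr; apply: eq_bigr => j _.
have jn : (nth 0%N p.2 j <= n)%N by apply: (allP (allP bs p ps)); rewrite mem_nth// sp.
rewrite (bigD1 (inord (nth 0%N p.2 j)))//= inordK// eqxx big1 ?addr0; last first.
  move=> i ij; rewrite ifN ?mulr0//; apply: contra ij => /eqP ->; by rewrite inord_val.
by rewrite signzE signr_odd; ring.
Qed.

End Evaluation.

(** * Hodge star in a coframe *)

Section Star.
Context {R : realType} {n : nat}.

Lemma mono_castmx k k' (e : k = k') I (v : 'M[R]_(k, n.+1)) :
  mono I (castmx (e, erefl) v) = mono I v.
Proof. by subst k'; rewrite castmx_id. Qed.

Lemma mul_castmx k k' p q (e : k = k') (v : 'M[R]_(k, p)) (C : 'M[R]_(p, q)) :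
  castmx (e, erefl) v *m C = castmx (e, erefl) (v *m C).
Proof. by subst k'; rewrite !castmx_id. Qed.

Lemma det_mono (v : 'M[R]_n.+1) : \det v = mono (iota 0 n.+1) v.
Proof.
congr (\det _); apply/matrixP => i j; rewrite mxE nth_iota// add0n.
by rewrite inord_val.
Qed.

Lemma alternating_col k l (a : 'M[R]_(k + l, n.+1) -> R) w :
  alternating a -> alternating (fun u => a (col_mx u w)).
Proof.
move=> [la za]; split=> [A B C i s t AE jE|A i j ij AE].
- apply: (la (col_mx A w) _ _ (lshift l i)); first by rewrite !rowKu.
  move=> j; case: (split_ordP j) => j' ->; last by rewrite !rowKd.
  by rewrite (inj_eq (@lshift_inj _ _)) => /jE; rewrite !rowKu.
- apply: (za (col_mx A w) (lshift l i) (lshift l j)); last by rewrite !rowKu.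
  by rewrite (inj_eq (@lshift_inj _ _)).
Qed.

(** With the basis vectors of [I] as first rows the minor is block lower triangular with an identity
    block, because the indices are distinct and in range. *)
Lemma mono_col_basis k l I J (w : 'M[R]_(l, n.+1)) :
  uniq (I ++ J) -> all (fun i => i < n.+1)%N (I ++ J) -> size I = k -> size J = l ->
  mono (I ++ J) (col_mx (rowsub (fun i : 'I_k => inord (nth 0%N I i)) 1%:M) w) = mono J w.
Proof.
move=> uIJ bIJ sI sJ; have inord_inj i j : (i < k + l)%N -> (j < k + l)%N ->
    (inord (nth 0%N (I ++ J) i) == inord (nth 0%N (I ++ J) j) :> 'I_n.+1) = (i == j).
  move=> ik jk; have sz : size (I ++ J) = (k + l)%N by rewrite size_cat sI sJ.
  rewrite -val_eqE/= !inordK ?nth_uniq ?sz//; by apply: (allP bIJ); rewrite mem_nth// sz.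
transitivity (\det (block_mx (1%:M : 'M[R]_k) 0 (\matrix_(i, j) w i (inord (nth 0%N I j)))
    (\matrix_(i < l, j < l) w i (inord (nth 0%N J j))))); last first.
  by rewrite det_lblock det1 mul1r.
congr (\det _); apply/matrixP => i j; rewrite mxE.
case: (split_ordP i) => i' ->; case: (split_ordP j) => j' ->.
- rewrite block_mxEul col_mxEu !mxE.
  have := inord_inj i' j'; rewrite !nth_cat/= sI !ltn_ord => ->//; exact: ltn_addr.
- rewrite block_mxEur col_mxEu !mxE.
  have := inord_inj i' (rshift k j'); rewrite (_ : nth 0%N (I ++ J) i' = nth 0%N I i') => [->|].
  - by rewrite ltn_eqF//= ltn_addr.
  - exact: ltn_addr.
  - exact: ltn_ord (rshift k j').
  - by rewrite nth_cat sI ltn_ord.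
- by rewrite block_mxEdl col_mxEd !mxE nth_cat sI/= ltn_ord.
- by rewrite block_mxEdr col_mxEd !mxE nth_cat sI/= ltnNge leq_addr/= addKn.
Qed.

Variable C : 'M[R]_n.+1.
Hypothesis Cu : C \in unitmx.

Lemma invmx_gram : invmx (C *m C^T) *m C = (invmx C)^T.
Proof.
have CTu : C^T \in unitmx by rewrite unitmx_tr.
rewrite trmx_inv; apply: (can_inj (mulKmx CTu)); rewrite mulmxV//.
apply: (can_inj (mulKmx Cu)); rewrite mulmx1 !mulmxA mulmxV ?mul1mx//.
by rewrite unitmx_mul Cu.
Qed.

(** The columns of [C] are a coframe, orthonormal for [C *m C^T]. The sum over [f] in [star] is the
    monomial expansion of the alternating function [F], evaluated at the rows of [invmx C] listed in
    [I], which [C] sends to basis vectors. *)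
Lemma star_mono k I (w : 'M[R]_(n.+1 - k, n.+1)) (e : (k + (n.+1 - k))%N = n.+1) :
  star (C *m C^T) (fun v => \det (v *m C)) (fun v => mono I (v *m C)) w =
  mono (iota 0 n.+1) (col_mx (rowsub (fun i : 'I_k => inord (nth 0%N I i)) 1%:M) (w *m C)).
Proof.
pose F (u : 'M[R]_(k, n.+1)) := mono (iota 0 n.+1) (col_mx u w *m C).
have Falt : alternating F.
  apply: (@alternating_col k _ (fun A => mono (iota 0 n.+1) (A *m C)) w).
  exact/alternating_pullback/alternating_mono.
have FE u : \det (conform_mx (0 : 'M[R]_n.+1) (col_mx u w) *m C) = F u.
  rewrite -(conform_castmx (e, erefl n.+1)) conform_mx_id mul_castmx det_mono.
  by rewrite mono_castmx.
rewrite /star; under eq_bigr do rewrite FE.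
(* Raising indices turns [C] into its transposed inverse, and transposing the minor exchanges the
   roles of [f] and [I]. *)
have E (f : {ffun 'I_k -> 'I_n.+1}) : mono I (rowsub f (invmx (C *m C^T)) *m C) =
    mono (seqf f) (rowsub (fun i : 'I_k => inord (nth 0%N I i)) (invmx C)).
  rewrite mul_rowsub_mx invmx_gram /mono -det_tr; congr (\det _).
  by apply/matrixP => i j; rewrite !mxE nth_seqf inord_val.
under eq_bigr do rewrite E mulrC.
rewrite mulr_sumr; under eq_bigr do rewrite mulrA.
by rewrite -alternating_mono_sum// /F mul_col_mx mul_rowsub_mx mulVmx.
Qed.

Lemma star_sum k (I : Type) (r : seq I) (G : 'M[R]_n.+1) vol (c : I -> R) (F : I -> 'M[R]_(k, n.+1) -> R) w :
  star G vol (fun v => \sum_(i <- r) c i * F i v) w = \sum_(i <- r) c i * star G vol (F i) w.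
Proof.
rewrite /star; under [RHS]eq_bigr => i _ do rewrite mulrCA mulr_sumr.
rewrite -mulr_sumr exchange_big/=; congr (_ * _); apply: eq_bigr => f _.
by rewrite mulr_suml; apply: eq_bigr => i _; rewrite mulrA.
Qed.

Lemma star_ev k s (w : 'M[R]_(n.+1 - k, n.+1)) : (k <= n.+1)%N -> starrable n.+1 k s ->
  star (C *m C^T) (fun v => \det (v *m C)) (fun v => @ev _ _ k s (v *m C)) w =
  ev (sstar n.+1 s) (w *m C).
Proof.
move=> kn sts; have e : (k + (n.+1 - k))%N = n.+1 by rewrite subnKC.
rewrite (star_sum s _ _ (fun p => p.1%:~R) (fun p v => mono p.2 (v *m C))).
rewrite /ev big_map big_seq [RHS]big_seq; apply: eq_bigr => p /(allP sts).
move=> /and5P[/eqP sp /eqP sc u b]; rewrite star_mono//.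
case E : sort_sign => [[sg J]|]// /eqP J0.
rewrite -(mono_col_basis (w *m C) u b sp sc) -[p.2 ++ _]cat0s mono_sort; last first.
  by rewrite add0n size_cat sp sc e.
rewrite /= E J0/=; case: sg {E} => /=; rewrite ?mul1r//.
by rewrite mulrNz mulN1r mulrNN.
Qed.

End Star.

(** * Smooth functions *)

Section Smooth.
Context {R : realType} {n : nat}.
Implicit Types (W : normedModType R) (U : set 'rV[R]_n).

Lemma near_eq_differentiable W (f g : 'rV[R]_n -> W) x :
  (\forall y \near x, f y = g y) -> differentiable f x -> differentiable g x.
Proof.
move=> fg df; have fgx : f x = g x by exact: nbhs_singleton fg.
have [dfc dfo] := (diff_locallyP x f).1 df.
have dgo : g \o shift x = cst (g x) + 'd f x +o_ 0 id.
  apply/eqaddoP => e e0; have /eqaddoP/(_ e e0) dfe := dfo.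
  have fg0 : \forall y \near (0 : 'rV[R]_n), f (y + x) = g (y + x).
    by move: fg; rewrite (near_shift 0 x); apply: filterS => y /=; rewrite subr0.
  by apply: filterS2 fg0 dfe => y /= E; rewrite !fctE /= E fgx.
by apply/diff_locallyP; rewrite (diff_unique dfc dgo).
Qed.

(** [smooth_on] treats all lists of directions at once; grading by the order of differentiability
    makes closure under products provable by induction. *)
Fixpoint ck W (m : nat) U (f : 'rV[R]_n -> W) : Prop :=
  (forall x, U x -> differentiable f x) /\
  if m is m'.+1 then forall v, ck m' U ('D_v f) else True.

Lemma ck_differentiable W m U (f : 'rV[R]_n -> W) :
  ck m U f -> forall x, U x -> differentiable f x.
Proof. by case: m => [|m] []. Qed.

Lemma ck_pred W m U (f : 'rV[R]_n -> W) : ck m.+1 U f -> ck m U f.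
Proof.
elim: m f => [|m IH] f [df dDf]; first by split.
by split=> // v; exact/IH/dDf.
Qed.

Lemma smooth_ck W U (f : 'rV[R]_n -> W) : smooth_on U f <-> forall m, ck m U f.
Proof.
split=> [|fck s].
  move=> + m; elim: m f => [|m IH] f fs; (split; first by move=> x Ux; exact: (fs [::])) => //.
  by move=> v; apply: IH => s x Ux; have := fs (rcons s v) x Ux; rewrite foldr_rcons.
elim/last_ind: s f fck => [|s v IH] f fck x Ux; first exact: ck_differentiable (fck 0%N) _ Ux.
by rewrite foldr_rcons; apply: IH Ux => m; exact: (fck m.+1).2.
Qed.

Section Closure.
Variable U : set 'rV[R]_n.
Hypothesis oU : open U.

Lemma eq_ck W m (f g : 'rV[R]_n -> W) :
  (forall x, U x -> f x = g x) -> ck m U f -> ck m U g.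
Proof.
elim: m f g => [|m IH] f g fg [df dDf].
  by split=> // x Ux; apply: near_eq_differentiable (df _ Ux); exact: near_open fg.
split=> [x Ux|v]; first by apply: near_eq_differentiable (df _ Ux); exact: near_open fg.
apply: IH (dDf v) => x Ux; apply: near_eq_derive; exact: near_open fg.
Qed.

Lemma ckD W m (f g : 'rV[R]_n -> W) : ck m U f -> ck m U g -> ck m U (f + g).
Proof.
elim: m f g => [|m IH] f g [df dDf] [dg dDg].
  by split=> // x Ux; apply: differentiableD; [exact: df|exact: dg].
split=> [x Ux|v]; first by apply: differentiableD; [exact: df|exact: dg].
apply: eq_ck (IH _ _ (dDf v) (dDg v)) => x Ux.
by rewrite deriveD//; apply: diff_derivable; [exact: df|exact: dg].
Qed.

Lemma ck_cst W m (c : W) : ck m U (cst c).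
Proof.
have D0 (v : 'rV[R]_n) : 'D_v (cst c) = cst 0 by apply/funext => x; rewrite derive_cst.
elim: m c D0 => [|m IH] c D0; first by split=> // x _; exact: differentiable_cst.
split=> [x _|v]; first exact: differentiable_cst.
by rewrite D0; apply: IH => w; apply/funext => x; rewrite derive_cst.
Qed.

Lemma ckM m (f g : 'rV[R]_n -> R^o) : ck m U f -> ck m U g -> ck m U (f * g : _ -> R^o).
Proof.
elim: m f g => [|m IH] f g fck gck.
  split=> // x Ux; apply: differentiableM; [exact: ck_differentiable fck _ Ux|exact: ck_differentiable gck _ Ux].
have df := ck_differentiable fck; have dg := ck_differentiable gck.
split=> [x Ux|v]; first by apply: differentiableM; [exact: df|exact: dg].
apply: eq_ck (ckD (IH _ _ (ck_pred fck) (gck.2 v)) (IH _ _ (ck_pred gck) (fck.2 v))) => x Ux.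
by rewrite deriveM//; apply: diff_derivable; [exact: df|exact: dg].
Qed.

Lemma ckZl W m (f : 'rV[R]_n -> R^o) (c : W) : ck m U f -> ck m U (fun x => f x *: c).
Proof.
elim: m f => [|m IH] f fck.
  by split=> // x Ux; apply: differentiableZl; exact: ck_differentiable fck _ Ux.
split=> [x Ux|v]; first by apply: differentiableZl; exact: ck_differentiable fck _ Ux.
apply: eq_ck (IH _ (fck.2 v)) => x Ux.
have df := ck_differentiable fck Ux.
rewrite [RHS]deriveE; last exact: differentiableZl.
by rewrite diffZl//= deriveE.
Qed.

Lemma eq_smooth W (f g : 'rV[R]_n -> W) :
  (forall x, U x -> f x = g x) -> smooth_on U f -> smooth_on U g.
Proof. by move=> fg /smooth_ck fs; apply/smooth_ck => m; exact: eq_ck fg (fs m). Qed.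

Lemma smoothD W (f g : 'rV[R]_n -> W) :
  smooth_on U f -> smooth_on U g -> smooth_on U (fun x => f x + g x).
Proof. by move=> /smooth_ck fs /smooth_ck gs; apply/smooth_ck => m; exact: (ckD (fs m) (gs m)). Qed.

Lemma smooth_cst W (c : W) : smooth_on U (fun _ => c).
Proof. by apply/smooth_ck => m; exact: (@ck_cst W m c). Qed.

Lemma smoothM (f g : 'rV[R]_n -> R^o) :
  smooth_on U f -> smooth_on U g -> smooth_on U (fun x => f x * g x : R^o).
Proof. by move=> /smooth_ck fs /smooth_ck gs; apply/smooth_ck => m; exact: (ckM (fs m) (gs m)). Qed.

Lemma smoothZl W (f : 'rV[R]_n -> R^o) (c : W) :
  smooth_on U f -> smooth_on U (fun x => f x *: c).
Proof. by move=> /smooth_ck fs; apply/smooth_ck => m; exact: ckZl. Qed.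

Lemma smooth_sum W (I : Type) (r : seq I) (P : pred I) (F : I -> 'rV[R]_n -> W) :
  (forall i, P i -> smooth_on U (F i)) -> smooth_on U (fun x => \sum_(i <- r | P i) F i x).
Proof.
move=> Fs; elim: r => [|i r IH].
  by apply: eq_smooth (smooth_cst 0) => x _; rewrite big_nil.
have [Pi|/negbTE Pi] := boolP (P i).
  by apply: eq_smooth (smoothD (Fs i Pi) IH) => x _; rewrite big_cons Pi.
by apply: eq_smooth IH => x _; rewrite big_cons Pi.
Qed.

Lemma smooth_derive W (f : 'rV[R]_n -> W) v : smooth_on U f -> smooth_on U ('D_v f).
Proof. by move=> fs s x Ux; have := fs (rcons s v) x Ux; rewrite foldr_rcons. Qed.

Lemma smooth_differentiable W (f : 'rV[R]_n -> W) x : smooth_on U f -> U x -> differentiable f x.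
Proof. by move=> /(_ [::]); exact. Qed.

Lemma smooth_extd k (a : lform R n k) :
  (forall v, smooth_on U (fun x => a x v : R^o)) ->
  forall v, smooth_on U (fun x => extd a x v : R^o).
Proof.
move=> sa v; apply: smooth_sum => j _; apply: smoothM; first exact: smooth_cst.
exact: smooth_derive.
Qed.

Lemma smooth_wedge k l (a : lform R n k) (b : lform R n l) :
  (forall v, smooth_on U (fun x => a x v : R^o)) ->
  (forall v, smooth_on U (fun x => b x v : R^o)) ->
  forall v, smooth_on U (fun x => wedge (a x) (b x) v : R^o).
Proof.
move=> sa sb v; apply: smoothM; first exact: smooth_cst.
apply: smooth_sum => s _; apply: smoothM => //; apply: smoothM => //; exact: smooth_cst.
Qed.

End Closure.
End Smooth.

(** * The flat model *)

(* In the model, eta = dx0, omega = dx1 dx2 + dx3 dx4 + dx5 dx6 and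
   Ups = (dx1 + i dx2)(dx3 + i dx4)(dx5 + i dx6); [s_om2] is omega^2, and [s_psi2] is twice
   the dual of [s_phi]. *)
Section Models.
Local Open Scope nat_scope.

Definition s_eta : sparse := [:: (1%Z, [:: 0])].
Definition s_om : sparse := [:: (1%Z, [:: 1; 2]); (1%Z, [:: 3; 4]); (1%Z, [:: 5; 6])].
Definition s_re : sparse :=
  [:: (1%Z, [:: 1; 3; 5]); ((-1)%Z, [:: 1; 4; 6]); ((-1)%Z, [:: 2; 3; 6]); ((-1)%Z, [:: 2; 4; 5])].
Definition s_im : sparse :=
  [:: (1%Z, [:: 1; 3; 6]); (1%Z, [:: 1; 4; 5]); (1%Z, [:: 2; 3; 5]); ((-1)%Z, [:: 2; 4; 6])].
Definition s_vol : sparse := [:: (1%Z, [:: 0; 1; 2; 3; 4; 5; 6])].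
Definition s_phi := s_re ++ swedge s_eta s_om.
Definition s_om2 : sparse := [:: (2%Z, [:: 1; 2; 3; 4]); (2%Z, [:: 1; 2; 5; 6]); (2%Z, [:: 3; 4; 5; 6])].
Definition s_psi2 := s_om2 ++ scale (-2)%Z (swedge s_eta s_im).

Lemma s_om2E : same 4 (swedge s_om s_om) s_om2.
Proof. by vm_compute. Qed.

Lemma star_s_phi : starrable 7 3 s_phi && same 4 (scale 2 (sstar 7 s_phi)) s_psi2.
Proof. by vm_compute. Qed.

Lemma star_s_psi2 : starrable 7 4 s_psi2 && same 3 (sstar 7 s_psi2) (scale 2 s_phi).
Proof. by vm_compute. Qed.

Lemma star_s_om2 : starrable 7 4 s_om2 && same 3 (sstar 7 s_om2) (scale 2 (swedge s_eta s_om)).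
Proof. by vm_compute. Qed.

Lemma s_phi_om2 : same 7 (swedge s_phi s_om2) (scale 6 s_vol).
Proof. by vm_compute. Qed.

Lemma star_s_vol : starrable 7 7 s_vol && same 0 (sstar 7 s_vol) [:: (1%Z, [::])].
Proof. by vm_compute. Qed.

(** By type: omega is (1,1) and Ups is (3,0), so their product would have type (4,1) in complex
    dimension 3. This makes eta Im Ups closed. *)
Lemma s_om_im : same 5 (swedge s_om s_im) [::].
Proof. by vm_compute. Qed.

Lemma s_eta_om3 : same 7 (swedge s_eta (swedge s_om2 s_om)) (scale 6 s_vol).
Proof. by vm_compute. Qed.

Definition s_vol6 : sparse := [:: (1%Z, [:: 1; 2; 3; 4; 5; 6])].

Lemma s_om3 : same 6 (swedge s_om2 s_om) (scale 6 s_vol6).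
Proof. by vm_compute. Qed.

Lemma s_re_re : same 6 (swedge s_re s_re) [::].
Proof. by vm_compute. Qed.

Lemma s_im_im : same 6 (swedge s_im s_im) [::].
Proof. by vm_compute. Qed.

(** With [s_im_re] this gives -8 i vol for Ups wedged with its conjugate, the value for which the
    factor i/8 in the definition of the norm yields 1. *)
Lemma s_re_im : same 6 (swedge s_re s_im) (scale 4 s_vol6).
Proof. by vm_compute. Qed.

Lemma s_im_re : same 6 (swedge s_im s_re) (scale (-4) s_vol6).
Proof. by vm_compute. Qed.

Lemma s_phi_contract : all (fun i => all (fun j =>
  [&& degree 2 (scontract i s_phi), degree 4 (swedge (scontract i s_phi) (scontract j s_phi)) &
  same 7 (swedge (swedge (scontract i s_phi) (scontract j s_phi)) s_phi)
    (if i == j then scale 6 s_vol else [::])]) (iota 0 7)) (iota 0 7).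
Proof. by vm_compute. Qed.

End Models.

(** * Adapted coframes *)

Section Inner.
Context {R : realType} {n : nat} (g : 'M[R]_n).

Lemma inner_combl c d u u' w :
  inner g (c *: u + d *: u') w = c * inner g u w + d * inner g u' w.
Proof. by rewrite /inner !mulmxDl -!scalemxAl !mxE. Qed.

Lemma inner_combr c d u w w' :
  inner g u (c *: w + d *: w') = c * inner g u w + d * inner g u w'.
Proof. by rewrite /inner linearD/= !linearZ/= mulmxDr -!scalemxAr !mxE. Qed.

Lemma innerZl c u w : inner g (c *: u) w = c * inner g u w.
Proof. by rewrite /inner -!scalemxAl !mxE. Qed.

Lemma innerZr c u w : inner g u (c *: w) = c * inner g u w.
Proof. by rewrite /inner linearZ/= -!scalemxAr !mxE. Qed.

Lemma inner0l w : inner g 0 w = 0.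
Proof. by rewrite -(scale0r 0) innerZl mul0r. Qed.

Lemma inner0r w : inner g w 0 = 0.
Proof. by rewrite -(scale0r 0) innerZr mul0r. Qed.

Lemma innerNr u w : inner g u (- w) = - inner g u w.
Proof. by rewrite -scaleN1r innerZr mulN1r. Qed.

Lemma innerC u w : g^T = g -> inner g u w = inner g w u.
Proof.
move=> gT; rewrite /inner.
have -> : (u *m g *m w^T) 0 0 = (u *m g *m w^T)^T 0 0 by rewrite [RHS]mxE.
by rewrite !trmx_mul trmxK gT mulmxA.
Qed.

(** Fewer than [n] orthogonality conditions have a nonzero solution, found in the kernel of [W]; its
    length is then adjusted to [c]. *)
Lemma exists_orthonormal (ws : seq 'rV[R]_n) c : posdef g -> 0 < c ->
  (size ws < n)%N ->
  exists u, inner g u u = c /\ (forall w, w \in ws -> inner g u w = 0).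
Proof.
move=> [gT gpos] c0 sn; pose W := g *m \matrix_(i < n, j < size ws) (nth 0 ws j) 0 i.
have : kermx W != 0.
  apply: contraTneq sn => /eqP; rewrite kermx_eq0 -leqNgt /row_free => rW.
  by apply: leq_trans (rank_leq_col W); rewrite (eqP rW).
rewrite -nz_row_eq0; set u := nz_row _ => u0.
have uW : u *m W = 0 by apply/sub_kermxP/nz_row_sub.
have gu : 0 < inner g u u by exact: gpos.
exists (Num.sqrt (c / inner g u u) *: u); split=> [|w wws].
  rewrite innerZl innerZr mulrA -expr2 sqr_sqrtr ?divfK ?gt_eqF//.
  by rewrite divr_ge0// ltW.
rewrite innerZl; suff -> : inner g u w = 0 by rewrite mulr0.
have iw : (index w ws < size ws)%N by rewrite index_mem.
move/rowP: uW => /(_ (Ordinal iw)); rewrite mulmxA !mxE => uW0.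
rewrite /inner mxE -[RHS]uW0; apply: eq_bigr => i _.
by rewrite !mxE/= nth_index.
Qed.

End Inner.

Section Basis.
Context {R : realType} {n : nat}.

Definition basis_vec i : 'rV[R]_n.+1 := delta_mx 0 (inord i).

Definition basis_rows (I : seq nat) : 'M[R]_(size I, n.+1) :=
  rowsub (fun m : 'I_(size I) => inord (nth 0%N I m)) 1%:M.

Lemma basis_rows_cons i I (a : 'M[R]_((size I).+1, n.+1) -> R) :
  a (basis_rows (i :: I)) = contract (basis_vec i) a (basis_rows I).
Proof.
rewrite /contract; congr (a _); apply/matrixP => j l.
case: (@split_ordP 1 (size I) j) => j' ->.
  by rewrite [RHS](@col_mxEu R 1 (size I)) !mxE (ord1 j')/= eq_sym.
by rewrite [RHS](@col_mxEd R 1 (size I)) !mxE.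
Qed.

Lemma contract_basis_ev k i s (v : 'M[R]_(k, n.+1)) : (i <= n)%N ->
  degree k.+1 s -> all (fun p => all (fun i => i <= n)%N p.2) s ->
  contract (basis_vec i) (@ev _ _ k.+1 s) v = ev (scontract i s) v.
Proof.
move=> i_n ds bs; rewrite contract_ev// (bigD1 (inord i))//= big1 => [|j /negbTE ji].
  by rewrite addr0 mxE !eqxx mul1r inordK.
by rewrite mxE ji andbF mul0r.
Qed.

Lemma ev_basis_nil s : ev s (basis_rows [::]) = \sum_(p <- s) p.1%:~R.
Proof. by apply: eq_bigr => p _; rewrite /mono det_mx00 mulr1. Qed.

End Basis.

Arguments basis_vec {R n}.
Arguments basis_rows {R n}.

Lemma sum7E (R : realType) (F : 'I_7 -> R) :
  \sum_(i < 7) F i = F (inord 0) + F (inord 1) + F (inord 2) + F (inord 3)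
    + F (inord 4) + F (inord 5) + F (inord 6).
Proof.
rewrite !big_ord_recr big_ord0/= add0r.
by do 6?[congr (_ + _)]; congr F; apply: val_inj; rewrite /= inordK.
Qed.

Lemma mono2E (R : realType) n i j (v : 'M[R]_(2, n.+1)) :
  mono [:: i; j] v = v 0 (inord i) * v 1 (inord j) - v 0 (inord j) * v 1 (inord i).
Proof.
rewrite /mono (expand_det_row _ ord0) !big_ord_recl big_ord0 /cofactor !det_mx11 !mxE/=.
have -> : lift ord0 0 = 1 :> 'I_2 by apply: val_inj.
by rewrite /bump/= !addn0 expr0 expr1; ring.
Qed.

Section AlmostContactMetric.
Context {R : realType}.

(** The algebra of a Sasakian structure at one point, separated from charts and derivatives. *)
Record almost_contact (g Phi : 'M[R]_7) (xi : 'rV[R]_7) (eta : 'rV[R]_7 -> R) : Prop := {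
  acm_pos : posdef g;
  acm_linear : forall c d u w, eta (c *: u + d *: w) = c * eta u + d * eta w;
  acm_eta_xi : eta xi = 1;
  acm_Phi2 : forall u, u *m Phi *m Phi = - u + eta u *: xi;
  acm_compat : forall u w,
    inner g (u *m Phi) (w *m Phi) = inner g u w - eta u * eta w }.

Variables (g Phi : 'M[R]_7) (xi : 'rV[R]_7) (eta : 'rV[R]_7 -> R).
Hypothesis acm : almost_contact g Phi xi eta.

Let gpos : posdef g. Proof. by case: acm. Qed.
Let etaL c d u w : eta (c *: u + d *: w) = c * eta u + d * eta w. Proof. by case: acm. Qed.
Let eta_xi : eta xi = 1. Proof. by case: acm. Qed.
Let Phi2 u : u *m Phi *m Phi = - u + eta u *: xi. Proof. by case: acm. Qed.
Let compat u w : inner g (u *m Phi) (w *m Phi) = inner g u w - eta u * eta w.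
Proof. by case: acm. Qed.

Let gC u w : inner g u w = inner g w u. Proof. by apply: innerC; case: gpos. Qed.

Let etaZ c u : eta (c *: u) = c * eta u.
Proof. by have := etaL c 0 u 0; rewrite scale0r addr0 mul0r addr0. Qed.

(** The image p of [xi] is killed by Phi, so the formula for Phi^2 gives p = eta(p) xi; applying Phi
    to [xi] again gives eta(p) p = 0. *)
Lemma xi_Phi : xi *m Phi = 0.
Proof.
set p := xi *m Phi; have pP : p *m Phi = 0 by rewrite Phi2 eta_xi scale1r addNr.
have pE : p = eta p *: xi.
  by have := Phi2 p; rewrite pP mul0mx => /eqP; rewrite eq_sym addrC subr_eq0 => /eqP.
have : eta p *: p = 0 by rewrite -[RHS]pP [in RHS]pE -scalemxAl.
move=> /eqP; rewrite scaler_eq0 => /orP[/eqP e0|/eqP//].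
by rewrite pE e0 scale0r.
Qed.

Lemma inner_xi u : inner g u xi = eta u.
Proof.
by have := compat u xi; rewrite xi_Phi inner0r eta_xi mulr1 => /eqP; rewrite eq_sym subr_eq0 => /eqP.
Qed.

(** Computing Phi^3 u in two ways leaves the difference eta(Phi u) xi, and [xi] is not 0. *)
Lemma eta_Phi u : eta (u *m Phi) = 0.
Proof.
have : u *m Phi *m Phi *m Phi = - (u *m Phi) by rewrite (Phi2 u) mulmxDl mulNmx -scalemxAl xi_Phi scaler0 addr0.
rewrite Phi2 => /eqP; rewrite -subr_eq0 opprK addrAC addNr add0r scaler_eq0.
case/orP => /eqP // xi0; have := eta_xi; rewrite xi0 -[0](scale0r 0) etaZ mul0r => /eqP.
by rewrite eq_sym oner_eq0.
Qed.

Lemma inner_skew u w : inner g (u *m Phi) w = - inner g u (w *m Phi).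
Proof.
have := compat u (w *m Phi); rewrite Phi2 eta_Phi mulr0 subr0 => <-.
rewrite -[- w]scaleN1r inner_combr inner_xi eta_Phi mulr0 addr0; ring.
Qed.

Lemma inner_selfPhi u : inner g u (u *m Phi) = 0.
Proof.
apply/eqP; rewrite -[_ == _](mulrn_eq0 _ 2) mulr2n.
by rewrite -{1}[inner g u _]opprK -inner_skew gC addNr.
Qed.

Definition unitary_frame e1 e2 e3 :=
  [/\ [/\ eta e1 = 0, eta e2 = 0 & eta e3 = 0],
      [/\ inner g e1 e1 = 2^-1, inner g e2 e2 = 2^-1 & inner g e3 e3 = 2^-1],
      [/\ inner g e1 e2 = 0, inner g e1 e3 = 0 & inner g e2 e3 = 0] &
      [/\ inner g e1 (e2 *m Phi) = 0, inner g e1 (e3 *m Phi) = 0 & inner g e2 (e3 *m Phi) = 0]].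

Lemma exists_unitary_frame : exists e1 e2 e3, unitary_frame e1 e2 e3.
Proof.
have h : 0 < 2^-1 :> R by rewrite invr_gt0.
(* There are 1, 3 and 5 conditions, each time fewer than 7. Orthogonality to [xi] means lying in ker
   eta; orthogonality to the earlier vectors and to their images under [Phi] makes the frame
   unitary. *)
have [e1 [n1 o1]] := exists_orthonormal (ws := [:: xi]) gpos h isT.
have [e2 [n2 o2]] := exists_orthonormal (ws := [:: xi; e1; e1 *m Phi]) gpos h isT.
have [e3 [n3 o3]] := exists_orthonormal (ws := [:: xi; e1; e1 *m Phi; e2; e2 *m Phi]) gpos h isT.
exists e1, e2, e3; split; split=> //.
- by rewrite -inner_xi o1// !inE eqxx.
- by rewrite -inner_xi o2// !inE eqxx.
- by rewrite -inner_xi o3// !inE eqxx.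
- by rewrite gC o2// !inE eqxx ?orbT.
- by rewrite gC o3// !inE eqxx ?orbT.
- by rewrite gC o3// !inE eqxx ?orbT.
- by rewrite -[LHS]opprK -inner_skew gC o2 ?oppr0// !inE eqxx ?orbT.
- by rewrite -[LHS]opprK -inner_skew gC o3 ?oppr0// !inE eqxx ?orbT.
- by rewrite -[LHS]opprK -inner_skew gC o3 ?oppr0// !inE eqxx ?orbT.
Qed.

(** With Phi as multiplication by i, [e1] is multiplied by the unit complex number c - i s; this
    serves to cancel the phase of Ups. *)
Lemma unitary_frame_rotate e1 e2 e3 c s : c ^+ 2 + s ^+ 2 = 1 ->
  unitary_frame e1 e2 e3 -> unitary_frame (c *: e1 - s *: (e1 *m Phi)) e2 e3.
Proof.
move=> cs [[h1 h2 h3] [n1 n2 n3] [q12 q13 q23] [p12 p13 p23]].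
have -> : c *: e1 - s *: (e1 *m Phi) = c *: e1 + (- s) *: (e1 *m Phi) by rewrite scaleNr.
split; split=> //; rewrite ?etaL ?inner_combl ?inner_combr ?eta_Phi ?compat ?inner_skew.
- by rewrite h1; ring.
- by rewrite inner_selfPhi n1 h1 -[RHS]mulr1 -cs; ring.
- by rewrite q12 p12; ring.
- by rewrite q13 p13; ring.
- by rewrite p12 q12 h1; ring.
- by rewrite p13 q13 h1; ring.
Qed.

Definition frame_mx e1 e2 e3 : 'M[R]_7 :=
  \matrix_(i < 7) nth 0 [:: xi; e1; e1 *m Phi; e2; e2 *m Phi; e3; e3 *m Phi] i.

(* The metric of the model G2-structure: [2 g - eta^2], as [2 g] restricts on [ker eta] to
   [omega (., Phi .)]. *)
Definition model_metric : 'M[R]_7 :=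
  2 *: g - (\col_i eta (delta_mx 0 i)) *m (\row_i eta (delta_mx 0 i)).

Lemma inner_eta2 u w :
  inner ((\col_i eta (delta_mx 0 i)) *m (\row_i eta (delta_mx 0 i))) u w = eta u * eta w.
Proof.
have etaE (v : 'rV[R]_7) : eta v = \sum_i v 0 i * eta (delta_mx 0 i).
  rewrite {1}(row_sum_delta v).
  elim: (index_enum _) => [|i r IH].
    by rewrite !big_nil -[0](scale0r 0) etaZ mul0r.
  by rewrite !big_cons -[X in _ + X]scale1r etaL mul1r IH.
rewrite /inner mulmxA -mulmxA mxE big_ord1 !mxE; congr (_ * _).
  by rewrite [RHS]etaE; apply: eq_bigr => i _; rewrite !mxE.
by rewrite [RHS]etaE; apply: eq_bigr => i _; rewrite !mxE mulrC.
Qed.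

Lemma inner_model u w : inner model_metric u w = 2 * inner g u w - eta u * eta w.
Proof.
rewrite -inner_eta2 /inner mulmxBr mulmxBl mxE [in X in _ + X]mxE; congr (_ + _).
by rewrite -scalemxAr -scalemxAl mxE.
Qed.

Section UnitaryFrame.
Variables e1 e2 e3 : 'rV[R]_7.
Hypothesis fr : unitary_frame e1 e2 e3.

Let gxi u : inner g u xi = eta u. Proof. exact: inner_xi. Qed.
Let xig u : inner g xi u = eta u. Proof. by rewrite gC gxi. Qed.
Let eP u : eta (u *m Phi) = 0. Proof. exact: eta_Phi. Qed.
Let xiP : xi *m Phi = 0. Proof. exact: xi_Phi. Qed.
Let sk u w : inner g (u *m Phi) w = - inner g u (w *m Phi). Proof. exact: inner_skew. Qed.
Let self u : inner g u (u *m Phi) = 0. Proof. exact: inner_selfPhi. Qed.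

Let E := frame_mx e1 e2 e3.
Let f i : 'rV[R]_7 := nth 0 [:: xi; e1; e1 *m Phi; e2; e2 *m Phi; e3; e3 *m Phi] i.

Let rowE i : (i < 7)%N -> row (inord i) E = f i.
Proof. by move=> i7; rewrite rowK inordK. Qed.

Let frame_rules :=
  let: And4 (And3 h1 h2 h3) (And3 n1 n2 n3) (And3 q12 q13 q23) (And3 p12 p13 p23) := fr in
  (h1, h2, h3, (n1, n2, n3), (q12, q13, q23), (p12, p13, p23)).

Let frame_rules' : (inner g e2 e1 = 0) * (inner g e3 e1 = 0) * (inner g e3 e2 = 0) *
  (inner g e2 (e1 *m Phi) = 0) * (inner g e3 (e1 *m Phi) = 0) * (inner g e3 (e2 *m Phi) = 0).
Proof.
have H u w : inner g u (w *m Phi) = 0 -> inner g w (u *m Phi) = 0.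
  by move=> uw; rewrite -[LHS]opprK -sk gC uw oppr0.
by repeat match goal with |- (_ * _)%type => split end; (rewrite H// frame_rules || rewrite gC frame_rules).
Qed.

Lemma frame_gram : E *m model_metric *m E^T = 1%:M.
Proof.
apply/matrixP => i j.
have -> : (E *m model_metric *m E^T) i j = inner (model_metric) (row i E) (row j E).
  rewrite /inner -row_mul [LHS]mxE [RHS]mxE; apply: eq_bigr => k _.
  by congr (_ * _); [rewrite [RHS]mxE|rewrite !mxE].
rewrite inner_model !rowK mxE -val_eqE.
by case: i => [] [|[|[|[|[|[|[|//]]]]]]] i_lt; case: j => [] [|[|[|[|[|[|[|//]]]]]]] j_lt;
  rewrite /= ?gxi ?xig ?eP ?compat ?sk ?self ?frame_rules ?frame_rules' ?eta_xi; field.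
Qed.

Lemma frame_omega (v : 'M[R]_(2, 7)) :
  -2 * inner g (row 0 (v *m E)) (row 1 (v *m E) *m Phi) = ev s_om v.
Proof.
have K i j : (i < 7)%N -> (j < 7)%N -> -2 * inner g (f i) (f j *m Phi) =
    if [|| (i == 1) && (j == 2), (i == 3) && (j == 4) | (i == 5) && (j == 6)]%N then 1
    else if [|| (i == 2) && (j == 1), (i == 4) && (j == 3) | (i == 6) && (j == 5)]%N then -1
    else 0.
  by case: i => [|[|[|[|[|[|[|//]]]]]]] _; case: j => [|[|[|[|[|[|[|//]]]]]]] _;
    rewrite /f/= ?xiP ?Phi2 ?eP ?frame_rules ?scale0r ?addr0 ?inner0r ?innerNr ?xig ?eP ?compat ?sk ?self ?frame_rules ?frame_rules' ?eta_xi; field.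
transitivity (\sum_(i < 7) \sum_(j < 7) v 0 i * v 1 j * (-2 * inner g (row i E) (row j E *m Phi))).
  have suml (r : seq 'I_7) (c : 'I_7 -> R) (u : 'I_7 -> 'rV[R]_7) w :
      inner g (\sum_(i <- r) c i *: u i) w = \sum_(i <- r) c i * inner g (u i) w.
    elim: r => [|i r IH]; first by rewrite !big_nil inner0l.
    by rewrite !big_cons -[X in _ + X]scale1r inner_combl mul1r IH.
  have sumr (r : seq 'I_7) (c : 'I_7 -> R) (u : 'I_7 -> 'rV[R]_7) w :
      inner g w (\sum_(i <- r) c i *: u i) = \sum_(i <- r) c i * inner g w (u i).
    by rewrite gC suml; apply: eq_bigr => i _; rewrite gC.
  rewrite !row_mul [in LHS]mulmx_sum_row suml mulr_sumr; apply: eq_bigr => i _.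
  rewrite [row 1 v *m E]mulmx_sum_row mulmx_suml.
  under [X in inner g _ X]eq_bigr do rewrite -scalemxAl.
  rewrite sumr !mulr_sumr; apply: eq_bigr => j _; rewrite !mxE; ring.
rewrite sum7E !sum7E !rowE// !K//=.
by rewrite /s_om !ev_cons ev_nil !mono2E/=; ring.
Qed.

Lemma frame_eta (v : 'rV[R]_7) : eta (v *m E) = ev s_eta v.
Proof.
have eta0 : eta 0 = 0 by have := etaL 0 0 0 0; rewrite !scale0r addr0 !mul0r addr0.
have sumL (r : seq 'I_7) (c : 'I_7 -> R) (u : 'I_7 -> 'rV[R]_7) :
    eta (\sum_(i <- r) c i *: u i) = \sum_(i <- r) c i * eta (u i).
  elim: r => [|i r IH]; first by rewrite !big_nil eta0.
  by rewrite !big_cons -[X in _ + X]scale1r etaL mul1r IH.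
rewrite mulmx_sum_row sumL sum7E !rowE// /f/= eta_xi !eP !frame_rules.
by rewrite /s_eta ev_cons ev_nil /mono det_mx11 !mxE/=; ring.
Qed.

End UnitaryFrame.

End AlmostContactMetric.

(** * Forms of type (3,0) and the phase of Ups *)

Section HolomorphicVolume.
Context {R : realType}.
Implicit Types T S : 'M[R]_(3, 7) -> R.

(* Real and imaginary part of a (3,0)-form for the complex structure taking the odd basis
   vectors to their successors, which is horizontal for the basis vector 0. *)
Definition holo_pair T S : Prop :=
  [/\ alternating T, alternating S,
    forall w, contract (basis_vec 0) T w = 0 /\ contract (basis_vec 0) S w = 0
  & forall i, i \in [:: 1; 3; 5]%N -> forall w,
      contract (basis_vec i.+1) T w = - contract (basis_vec i) S w /\
      contract (basis_vec i.+1) S w = contract (basis_vec i) T w].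

Lemma holo_pair_model : holo_pair (ev s_re) (ev s_im).
Proof.
split; [exact: alternating_ev|exact: alternating_ev|move=> w|move=> i].
  by rewrite !contract_basis_ev//; split; rewrite -[RHS](@ev_nil R 6 2 w); apply: ev_same; vm_compute.
rewrite !inE => /or3P[] /eqP -> w; rewrite !contract_basis_ev// -mulN1r -[-1](mulrNz 1 1) -ev_scale;
  by split; apply: ev_same; vm_compute.
Qed.

(** These are the real and imaginary parts of (T + i S) - (c + i d) (T' + i S'). *)
Lemma holo_pair_comb T S T' S' c d :
  holo_pair T S -> holo_pair T' S' ->
  holo_pair (fun v => T v + (- c * T' v + d * S' v)) (fun v => S v + (- c * S' v + - d * T' v)).
Proof.
move=> [Ta Sa x0 TS] [Ta' Sa' x0' TS'].
have altD a b : alternating a -> alternating b -> alternating (fun v : 'M[R]_(3, 7) => a v + b v).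
  move=> aa ab; have := alternating_comb 1 1 aa ab; congr alternating.
  by apply/funext => v; rewrite !mul1r.
split; [exact/altD/alternating_comb|exact/altD/alternating_comb| |].
- move=> w; have [] := x0 w; have [] := x0' w; rewrite /contract => -> -> -> ->.
  by split; ring.
- move=> i i3 w; have [] := TS i i3 w; have [] := TS' i i3 w; rewrite /contract => -> -> -> ->.
  by split; ring.
Qed.

(* The rules defining [holo_pair] reduce every value on basis vectors to the one on
   (e_1, e_3, e_5). *)
Lemma holo_pair_eq0 T S : holo_pair T S ->
  T (basis_rows [:: 1; 3; 5]) = 0 -> S (basis_rows [:: 1; 3; 5]) = 0 ->
  forall v, T v = 0 /\ S v = 0.
Proof.
move=> [Ta Sa x0 TS] T0 S0.
pose Z i j k := T (basis_rows [:: i; j; k]) = 0 /\ S (basis_rows [:: i; j; k]) = 0.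
have swap (s : 'S_3) (a b : seq nat) (sa : size a = 3) (sb : size b = 3) :
    (forall i : 'I_3, nth 0%N b i = nth 0%N a (s i)) ->
    T (rowsub (fun m : 'I_3 => inord (nth 0%N a m)) 1%:M) = 0 /\
    S (rowsub (fun m : 'I_3 => inord (nth 0%N a m)) 1%:M) = 0 ->
    T (rowsub (fun m : 'I_3 => inord (nth 0%N b m)) 1%:M) = 0 /\
    S (rowsub (fun m : 'I_3 => inord (nth 0%N b m)) 1%:M) = 0.
  move=> ba; have -> : rowsub (fun m : 'I_3 => inord (nth 0%N b m)) 1%:M =
      row_perm s (rowsub (fun m : 'I_3 => inord (nth 0%N a m)) 1%:M) :> 'M[R]_(3, 7).
    by apply/matrixP => i j; rewrite !mxE ba.
  by rewrite !alternating_row_perm// => -[-> ->]; rewrite !mulr0.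
have Z12 i j k : Z i j k -> Z j i k.
  apply: (swap (tperm 0 1) [:: i; j; k] [:: j; i; k]) => // m.
  by case: tpermP => [->|->|/eqP m0 /eqP m1]//; case: m m0 m1 => [] [|[|[|//]]].
have Z23 i j k : Z i j k -> Z i k j.
  apply: (swap (tperm 1 (inord 2)) [:: i; j; k] [:: i; k; j]) => // m.
  case: tpermP => [->|->|/eqP m0 /eqP m1]; rewrite /= ?inordK//.
  by case: m m0 m1 => [] [|[|[|//]]] i_lt//; rewrite -!val_eqE/= inordK.
have Z0 j k : Z 0%N j k by have [? ?] := x0 (basis_rows [:: j; k]); split;
    [rewrite (@basis_rows_cons R 6 0 [:: j; k] T)|rewrite (@basis_rows_cons R 6 0 [:: j; k] S)].
have ZS i j k : i \in [:: 1; 3; 5]%N -> Z i j k -> Z i.+1 j k.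
  move=> i3 [Ti Si]; have [E1 E2] := TS i i3 (basis_rows [:: j; k]).
  rewrite /Z (@basis_rows_cons R 6 i.+1 [:: j; k] T) (@basis_rows_cons R 6 i.+1 [:: j; k] S) E1 E2.
  by rewrite -(@basis_rows_cons R 6 i [:: j; k] T) -(@basis_rows_cons R 6 i [:: j; k] S) Ti Si oppr0.
have Zd i k : Z i i k.
  have E01 : (0 : 'I_3) != 1 by [].
  by split; [apply: (Ta.2 _ 0 1 E01)|apply: (Sa.2 _ 0 1 E01)]; apply/rowP => m; rewrite !mxE.
(* Every index below 7 is 0, odd, or the successor of an odd one. Starting from odd arguments, the
   third, the second and the first are freed in this order. *)
have odd_ind (P : nat -> Prop) : P 0%N -> (forall i, i \in [:: 1; 3; 5]%N -> P i -> P i.+1) ->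
    P 1%N -> P 3%N -> P 5%N -> forall i, (i < 7)%N -> P i.
  by move=> P0 PS P1 P3 P5 [|[|[|[|[|[|[|//]]]]]]] _ //; exact: PS.
have Z135 : Z 1%N 3%N 5%N by [].
have Zo i j k : i \in [:: 1; 3; 5]%N -> j \in [:: 1; 3; 5]%N -> k \in [:: 1; 3; 5]%N -> Z i j k.
  rewrite !inE => /or3P[] /eqP -> /or3P[] /eqP -> /or3P[] /eqP ->;
    first [exact: Zd|exact/Z23/Zd|exact/Z12/Z23/Zd|exact: Z135|exact/Z12/Z135|exact/Z23/Z135
      |exact/Z12/Z23/Z135|exact/Z23/Z12/Z135|exact/Z12/Z23/Z12/Z135].
have Zk i j k : i \in [:: 1; 3; 5]%N -> j \in [:: 1; 3; 5]%N -> (k < 7)%N -> Z i j k.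
  move=> i3 j3; apply: (odd_ind (fun k => Z i j k)) k => [|k k3||| ]; [exact/Z23/Z12/Z0| |exact: Zo..].
  by move=> /Z23/Z12/(ZS _ _ _ k3)/Z12/Z23.
have Zj i j k : i \in [:: 1; 3; 5]%N -> (j < 7)%N -> (k < 7)%N -> Z i j k.
  move=> i3 j7 k7; move: j j7; apply: odd_ind => [|j j3||| ]; [exact/Z12/Z0| |exact: Zk..].
  by move=> /Z12/(ZS _ _ _ j3)/Z12.
have ZE i j k : (i < 7)%N -> (j < 7)%N -> (k < 7)%N -> Z i j k.
  move=> i7 j7 k7; move: i i7; apply: odd_ind => [|i i3||| ]; [exact: Z0|exact: ZS|exact: Zj..].
have EF (f : {ffun 'I_3 -> 'I_7}) : rowsub f 1%:M = basis_rows [:: val (f 0); val (f 1); val (f (inord 2))] :> 'M[R]_(3, 7).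
  apply/matrixP => i j; rewrite !mxE; congr (_ == _)%:R.
  apply: val_inj; case: i => [] [|[|[|//]]] i3; rewrite /= inordK//; congr (val (f _)); apply: val_inj => //=.
  by rewrite inordK.
move=> v; rewrite -[v]mulmx1 !alternating_mulmx//; split; apply: big1 => f _;
  rewrite EF; have [E1 E2] := ZE (f 0) (f 1) (f (inord 2)) (ltn_ord _) (ltn_ord _) (ltn_ord _).
  by rewrite E1 mulr0.
by rewrite E2 mulr0.
Qed.

(** Forms of type (3,0) make up a complex line: subtracting c + i d times the model leaves a pair
    that vanishes on (e_1, e_3, e_5), hence everywhere. *)
Lemma holo_pairE T S : holo_pair T S ->
  let c := T (basis_rows [:: 1; 3; 5]) in let d := S (basis_rows [:: 1; 3; 5]) in
  forall v, T v = c * ev s_re v - d * ev s_im v /\ S v = c * ev s_im v + d * ev s_re v.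
Proof.
move=> TS c d.
have base : @ev R 6 3 s_re (basis_rows [:: 1; 3; 5]) = 1 /\ @ev R 6 3 s_im (basis_rows [:: 1; 3; 5]) = 0.
  have E s : degree 3 s -> all (fun p => all (fun i => i <= 6)%N p.2) s ->
     degree 2 (scontract 1 s) -> all (fun p => all (fun i => i <= 6)%N p.2) (scontract 1 s) ->
     degree 1 (scontract 3 (scontract 1 s)) -> all (fun p => all (fun i => i <= 6)%N p.2) (scontract 3 (scontract 1 s)) ->
     @ev R 6 3 s (basis_rows [:: 1; 3; 5]) = \sum_(p <- scontract 5 (scontract 3 (scontract 1 s))) p.1%:~R :> R.
    move=> d3 b3 d2 b2 d1 b1.
    rewrite (@basis_rows_cons R 6 1 [:: 3; 5] (@ev R 6 3 s)) contract_basis_ev//.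
    rewrite (@basis_rows_cons R 6 3 [:: 5] (@ev R 6 2 _)) contract_basis_ev//.
    by rewrite (@basis_rows_cons R 6 5 [::] (@ev R 6 1 _)) contract_basis_ev// ev_basis_nil.
  split; rewrite E//; [rewrite (_ : scontract _ _ = [:: (1%Z, [::])])|rewrite (_ : scontract _ _ = [::])].
  - by rewrite big_cons big_nil addr0.
  - by vm_compute.
  - by rewrite big_nil.
  - by vm_compute.
have [b1 b2] := base.
have H := holo_pair_eq0 (holo_pair_comb c d TS holo_pair_model).
move=> v; have [] := H _ _ v.
- by rewrite b1 b2 -/c; ring.
- by rewrite b1 b2 -/d; ring.
by move=> E1 E2; split; [rewrite -[LHS]subr0 -E1|rewrite -[LHS]subr0 -E2]; ring.
Qed.

End HolomorphicVolume.

Section WedgeComb.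
Context {R : realType} {n k l : nat} {L : fieldType}.

Lemma wedge_combl (c d : L) (a a' : 'M[R]_(k, n) -> L) (b : 'M[R]_(l, n) -> L) v :
  wedge (fun w => c * a w + d * a' w) b v = c * wedge a b v + d * wedge a' b v.
Proof.
have := wedge_suml [:: true; false] (fun i => if i then c else d) (fun i : bool => if i then a else a') b v.
rewrite !big_cons big_nil addr0 => <-; congr wedge; apply/funext => w.
by rewrite !big_cons big_nil addr0.
Qed.

Lemma wedge_combr (c d : L) (a : 'M[R]_(k, n) -> L) (b b' : 'M[R]_(l, n) -> L) v :
  wedge a (fun w => c * b w + d * b' w) v = c * wedge a b v + d * wedge a b' v.
Proof.
have := wedge_sumr [:: true; false] (fun i => if i then c else d) a (fun i : bool => if i then b else b') v.
rewrite !big_cons big_nil addr0 => <-; congr wedge; apply/funext => w.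
by rewrite !big_cons big_nil addr0.
Qed.

End WedgeComb.

Section ComplexWedge.
Context {R : realType} {n k l : nat}.

Lemma wedge_real_complex (a : 'M[R]_(k, n) -> R) (b : 'M[R]_(l, n) -> R) v :
  wedge (fun w => (a w)%:C%C) (fun w => (b w)%:C%C) v = (wedge a b v)%:C%C :> R[i].
Proof.
rewrite /wedge [RHS]rmorphM/= [in RHS]fmorphV [in RHS]rmorph_nat [in RHS]rmorph_sum/=; congr (_ * _).
by apply: eq_bigr => s _; rewrite !rmorphM/= rmorph_sign.
Qed.

Lemma wedge_conj (U : 'M[R]_(k, n) -> R[i]) (V : 'M[R]_(l, n) -> R[i]) v :
  let A w := complex.Re (U w) in let B w := complex.Im (U w) in
  let A' w := complex.Re (V w) in let B' w := complex.Im (V w) in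
  wedge U (fun w => conjc (V w)) v =
  (wedge A A' v + wedge B B' v)%:C%C + 'i%C * (wedge B A' v - wedge A B' v)%:C%C.
Proof.
move=> A B A' B'.
rewrite (_ : U = fun w => 1 * (A w)%:C%C + 'i%C * (B w)%:C%C); last first.
  by apply/funext => w; rewrite mul1r -complexE.
rewrite (_ : (fun w => conjc (V w)) = fun w => 1 * (A' w)%:C%C + (- 'i%C) * (B' w)%:C%C); last first.
  apply/funext => w; rewrite /A' /B'; case: (V w) => x y /=.
  by apply/eqP; rewrite eq_complex/=; apply/andP; split; apply/eqP; ring.
rewrite wedge_combl !wedge_combr !wedge_real_complex !rmorphD/= rmorphN/=.
have i2 : 'i%C * 'i%C = -1 :> R[i] by rewrite -expr2 sqr_i.
move: ('i%C) i2 => i i2.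
transitivity ((wedge A A' v)%:C%C - (i * i) * (wedge B B' v)%:C%C + i * ((wedge B A' v)%:C%C - (wedge A B' v)%:C%C) : R[i]).
  by ring.
by rewrite i2 mulN1r opprK.
Qed.

End ComplexWedge.

Section Coframe.
Context {R : realType} (g Phi : 'M[R]_7) (xi : 'rV[R]_7) (eta : 'rV[R]_7 -> R).
Variables (om : 'M[R]_(2, 7) -> R) (U : 'M[R]_(3, 7) -> R[i]).

Let T v := complex.Re (U v).
Let S v := complex.Im (U v).

Hypothesis acm : almost_contact g Phi xi eta.
Hypothesis omE : forall v, om v = -2 * inner g (row 0 v) (row 1 v *m Phi).
Hypothesis Talt : alternating T.
Hypothesis Salt : alternating S.
Hypothesis T_xi : forall w, contract xi T w = 0.
Hypothesis S_xi : forall w, contract xi S w = 0.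
Hypothesis U_type : forall u, eta u = 0 -> forall w,
  contract u U w + 'i%C * contract (u *m Phi) U w = 0.
Hypothesis U_norm : forall v,
  (((3`!)%:R^-1 * wedge (wedge om om) om v)%:C)%C =
  'i%C / 8 * ((1 ^+ 2)^-1)%:C%C * wedge U (fun w => conjc (U w)) v.

Let contract_Phi u w : eta u = 0 ->
  contract (u *m Phi) T w = - contract u S w /\ contract (u *m Phi) S w = contract u T w.
Proof.
move=> eu; have := U_type eu w; rewrite /contract /T /S.
case: (U _) => x y; case: (U _) => x' y' /eqP; rewrite eq_complex/= => /andP[/eqP E1 /eqP E2].
split.
- by rewrite -[LHS]subr0 -E2; ring.
- by rewrite -[LHS]addr0 -E1; ring.
Qed.

Let contract_frame e1 e2 e3 (a : 'M[R]_(3, 7) -> R) i (w : 'M[R]_(2, 7)) : (i < 7)%N ->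
  let E := frame_mx Phi xi e1 e2 e3 in
  contract (basis_vec i) (fun v => a (v *m E)) w =
  contract (nth 0 [:: xi; e1; e1 *m Phi; e2; e2 *m Phi; e3; e3 *m Phi] i) a (w *m E).
Proof.
move=> i7 E; rewrite /contract; congr (a _).
etransitivity; first exact: (@mul_col_mx R 1 2 7 7 (basis_vec i) w E).
by rewrite -rowE rowK inordK.
Qed.

Let holo_frame e1 e2 e3 : unitary_frame g Phi eta e1 e2 e3 ->
  let E := frame_mx Phi xi e1 e2 e3 in
  holo_pair (fun v => T (v *m E)) (fun v => S (v *m E)).
Proof.
move=> fr E; have [[h1 h2 h3] _ _ _] := fr; split.
- exact: alternating_pullback.
- exact: alternating_pullback.
- by move=> w; rewrite !contract_frame.
- move=> i; rewrite !inE => /or3P[] /eqP -> w; rewrite !contract_frame//=; exact: contract_Phi.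
Qed.

Let frame_unit e1 e2 e3 : unitary_frame g Phi eta e1 e2 e3 ->
  frame_mx Phi xi e1 e2 e3 \in unitmx.
Proof.
by move=> fr; have := frame_gram acm fr; rewrite -mulmxA => /mulmx1_unit[].
Qed.

(** In the frame Ups is c + i d times the model, so Ups wedged with its conjugate carries the factor
    c^2 + d^2; comparison with omega^3 on the six horizontal frame vectors makes it 1. *)
Let frame_norm e1 e2 e3 : unitary_frame g Phi eta e1 e2 e3 ->
  let E := frame_mx Phi xi e1 e2 e3 in
  T (basis_rows [:: 1; 3; 5] *m E) ^+ 2 + S (basis_rows [:: 1; 3; 5] *m E) ^+ 2 = 1.
Proof.
move=> fr E; have TS := holo_pairE (holo_frame fr).
set c := T _; set d := S _.
have omv (v : 'M[R]_(2, 7)) : om (v *m E) = ev s_om v.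
  by rewrite omE (frame_omega acm fr).
have om3 (v : 'M[R]_(6, 7)) : wedge (wedge om om) om (v *m E) = 6 * ev s_vol6 v.
  rewrite wedge_pullback (_ : (fun w => om (w *m E)) = ev s_om); last exact/funext.
  rewrite (_ : (fun w => wedge om om (w *m E)) = ev s_om2); last first.
    apply/funext => w; rewrite wedge_pullback (_ : (fun w => om (w *m E)) = ev s_om); last exact/funext.
    by rewrite ev_wedge// (ev_same w s_om2E).
  by rewrite ev_wedge// (ev_same v s_om3) ev_scale.
pose w : 'M[R]_(6, 7) := basis_rows [:: 1; 2; 3; 4; 5; 6].
have vol_w : ev s_vol6 w = 1.
  rewrite /s_vol6 ev_cons ev_nil addr0 mul1r /mono.
  rewrite (_ : \matrix_(i, j) _ = 1%:M) ?det1//; apply/matrixP => i j; rewrite !mxE.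
  by case: i => [] [|[|[|[|[|[|//]]]]]] i6; case: j => [] [|[|[|[|[|[|//]]]]]] j6;
    rewrite /= -!val_eqE/= !inordK.
have AE : (fun v => complex.Re (U (v *m E))) = fun v => c * ev s_re v + - d * ev s_im v.
  by apply/funext => v; rewrite mulNr; exact: (TS v).1.
have BE : (fun v => complex.Im (U (v *m E))) = fun v => c * ev s_im v + d * ev s_re v.
  by apply/funext => v; exact: (TS v).2.
have := U_norm (w *m E); rewrite om3 [in RHS]wedge_pullback wedge_conj AE BE.
rewrite !wedge_combl !wedge_combr !ev_wedge// (ev_same w s_re_re) (ev_same w s_im_im)
  (ev_same w s_re_im) (ev_same w s_im_re) !ev_scale !ev_nil vol_w.
set P := (X in (X%:C + _)%C); set Q := (X in (_ + 'i * X%:C)%C).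
have -> : P = 0 by rewrite /P; ring.
have -> : Q = -8 * (c ^+ 2 + d ^+ 2) by rewrite /Q; ring.
rewrite expr1n invr1 add0r mulr1.
have -> : (3`!)%:R^-1 * 6 = 1 :> R by rewrite mulVf// pnatr_eq0.
have -> : (-8 * (c ^+ 2 + d ^+ 2))%:C%C = -8 * (c ^+ 2 + d ^+ 2)%:C%C :> R[i].
  by rewrite rmorphM/= rmorphN rmorph_nat.
have i2 : 'i%C * 'i%C = -1 :> R[i] by rewrite -expr2 sqr_i.
have -> : 'i%C / 8 * 1%:C%C * ('i%C * (-8 * (c ^+ 2 + d ^+ 2)%:C%C)) =
    - ('i%C * 'i%C) * (c ^+ 2 + d ^+ 2)%:C%C :> R[i].
  by move: ('i%C); have -> : 1%:C%C = 1 :> R[i] by []; move=> i; field.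
by rewrite i2 opprK mul1r => /complexI.
Qed.

Lemma exists_coframe : exists C : 'M[R]_7,
  [/\ C \in unitmx, C *m C^T = model_metric g eta,
      forall v, eta v = ev s_eta (v *m C),
      forall v, om v = ev s_om (v *m C)
    & (forall v, complex.Re (U v) = ev s_re (v *m C)) /\
      (forall v, complex.Im (U v) = ev s_im (v *m C))].
Proof.
have [e1 [e2 [e3 fr]]] := exists_unitary_frame acm.
pose E := frame_mx Phi xi e1 e2 e3.
pose c := T (basis_rows [:: 1; 3; 5] *m E); pose d := S (basis_rows [:: 1; 3; 5] *m E).
have cd : c ^+ 2 + d ^+ 2 = 1 by exact: frame_norm fr.
(* The value of Ups on the frame is c + i d; multiplying [e1] by c - i d changes it to c^2 + d^2 =
   1. *)
have fr' := unitary_frame_rotate acm cd fr; pose e1' := c *: e1 - d *: (e1 *m Phi); rewrite -/e1' in fr'.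
pose E' := frame_mx Phi xi e1' e2 e3.
have [[h1 _ _] _ _ _] := fr.
have c1 (a : 'M[R]_(3, 7) -> R) f1 : a (basis_rows [:: 1; 3; 5] *m frame_mx Phi xi f1 e2 e3) =
    contract f1 a (\matrix_(i < 2) if i == 0 then e2 else e3).
  rewrite (@basis_rows_cons R 6 1 [:: 3; 5] (fun v => a (v *m _))) contract_frame//=.
  congr contract; rewrite mul_rowsub_mx mul1mx; apply/row_matrixP => i.
  rewrite rowK (_ : row i _ = row (inord (nth 0%N [:: 3; 5]%N i)) (frame_mx Phi xi f1 e2 e3)); last first.
    by apply/rowP => j; rewrite !mxE.
  by rewrite rowK; case: i => [] [|[|//]] i2; rewrite /= inordK.
have e1'E (a : 'M[R]_(3, 7) -> R) w : alternating a ->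
    contract e1' a w = c * contract e1 a w - d * contract (e1 *m Phi) a w.
  by move=> aalt; rewrite /e1' -scaleNr contractDl// mulNr.
have T1 : T (basis_rows [:: 1; 3; 5] *m E') = 1.
  by rewrite c1 e1'E// (contract_Phi _ h1).1 -!c1 -/c -/d -cd; ring.
have S1 : S (basis_rows [:: 1; 3; 5] *m E') = 0.
  by rewrite c1 e1'E// (contract_Phi _ h1).2 -!c1 -/c -/d; ring.
have Eu : E' \in unitmx by exact: frame_unit.
have TS := holo_pairE (holo_frame fr').
(* Vectors are rows and the frame is the rows of [E'], so [v *m invmx E'] is the row of frame
   components of [v]. *)
exists (invmx E'); split.
- by rewrite unitmx_inv.
- have EG := frame_gram acm fr'.
  rewrite -[RHS](mulKmx Eu) -[in RHS](mulmxK (_ : E'^T \in unitmx) (model_metric g eta)) ?unitmx_tr//.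
  by rewrite [X in _ = _ *m X]mulmxA [X in _ = _ *m (X *m _)]mulmxA EG mul1mx trmx_inv.
- by move=> v; rewrite -(frame_eta acm fr') mulmxKV.
- by move=> v; rewrite -(frame_omega acm fr') -omE mulmxKV.
- split=> v.
    by have := (TS (v *m invmx E')).1; rewrite T1 S1 mulmxKV// -/(T v) => ->; ring.
  by have := (TS (v *m invmx E')).2; rewrite T1 S1 mulmxKV// -/(S v) => ->; ring.
Qed.

End Coframe.

(** * The rescaled G2-structures at a point *)

Section PointwiseG2.
Context {R : realType}.

Lemma mono_diag n k I (d : 'rV[R]_n.+1) (v : 'M[R]_(k, n.+1)) :
  mono I (v *m diag_mx d) = (\prod_(j < k) d 0 (inord (nth 0%N I j))) * mono I v.
Proof.
rewrite /mono (_ : \matrix_(i, j) _ = (\matrix_(i < k, j < k) v i (inord (nth 0%N I j))) *m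
   diag_mx (\row_(j < k) d 0 (inord (nth 0%N I j)))).
  by rewrite det_mulmx det_diag mulrC; congr (_ * _); apply: eq_bigr => j _; rewrite mxE.
by apply/matrixP => i j; rewrite mxE !mul_mx_diag !mxE.
Qed.

(* The coframe change multiplying the first covector by [a] and the others by [b]. *)
Definition rescale (a b : R) : 'M[R]_7 := diag_mx (\row_(i < 7) if i == 0 then a else b).

(** [z] counts the eta factors of each monomial; these scale by [a], the other k - z by [b]. *)
Definition homogeneous k z (s : sparse) :=
  all (fun p => [&& size p.2 == k, count_mem 0%N p.2 == z & all (fun i => i <= 6)%N p.2]) s.

Lemma ev_rescale k z s a b (v : 'M[R]_(k, 7)) : homogeneous k z s ->
  ev s (v *m rescale a b) = a ^+ z * b ^+ (k - z) * ev s v.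
Proof.
move=> hs; rewrite /ev mulr_sumr big_seq [RHS]big_seq; apply: eq_bigr => p /(allP hs).
move=> /and3P[/eqP sp /eqP cp bp]; rewrite mono_diag mulrCA mulrA [RHS]mulrCA mulrA; congr (_ * _).
rewrite mulrC; congr (_ * _).
have -> : \prod_(j < k) (\row_(i < 7) (if i == 0 then a else b)) 0 (inord (nth 0%N p.2 j)) =
    \prod_(j <- p.2) if j == 0%N then a else b.
  rewrite (big_nth 0%N) sp big_mkord; apply: eq_bigr => j _.
  have jp : (nth 0%N p.2 j <= 6)%N by apply: (allP bp); rewrite mem_nth// sp.
  by rewrite mxE -val_eqE/= inordK.
rewrite -sp -cp; elim: (p.2) => [|x I IH]; first by rewrite big_nil !expr0 mulr1.
rewrite big_cons IH /=; case: eqVneq => _; first by rewrite /= add1n subSS exprS mulrA.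
by rewrite add0n subSn ?count_size// exprS mulrCA.
Qed.

Lemma starZ n k (G : 'M[R]_n.+1) vol c (F : 'M[R]_(k, n.+1) -> R) w :
  star G vol (fun v => c * F v) w = c * star G vol F w.
Proof.
have := star_sum [:: tt] G vol (fun=> c) (fun=> F) w.
rewrite big_cons big_nil addr0 => <-; congr star; apply/funext => v.
by rewrite big_cons big_nil addr0.
Qed.

Variables (C : 'M[R]_7) (eta : 'M[R]_(1, 7) -> R) (om : 'M[R]_(2, 7) -> R).
Variables (re im : 'M[R]_(3, 7) -> R).
Hypothesis Cu : C \in unitmx.
Hypothesis etaE : forall v, eta v = ev s_eta (v *m C).
Hypothesis omE : forall v, om v = ev s_om (v *m C).
Hypothesis reE : forall v, re v = ev s_re (v *m C).
Hypothesis imE : forall v, im v = ev s_im (v *m C).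

Let etaF : eta = fun v => ev s_eta (v *m C). Proof. exact/funext. Qed.
Let omF : om = fun v => ev s_om (v *m C). Proof. exact/funext. Qed.
Let imF : im = fun v => ev s_im (v *m C). Proof. exact/funext. Qed.

Lemma eta_omE v : wedge eta om v = ev (swedge s_eta s_om) (v *m C).
Proof. by rewrite etaF omF -wedge_pullback ev_wedge. Qed.

Lemma om_omE v : wedge om om v = ev s_om2 (v *m C).
Proof. by rewrite omF -wedge_pullback ev_wedge// (ev_same _ s_om2E). Qed.

Lemma eta_imE v : wedge eta im v = ev (swedge s_eta s_im) (v *m C).
Proof. by rewrite etaF imF -wedge_pullback ev_wedge. Qed.

Lemma wedge_om_im v : wedge om im v = 0.
Proof. by rewrite omF imF -wedge_pullback ev_wedge// (ev_same _ s_om_im) ev_nil. Qed.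

Lemma eta_om3E v : wedge eta (wedge (wedge om om) om) v = 6 * \det (v *m C).
Proof.
rewrite (_ : wedge (wedge om om) om = fun w => ev (swedge s_om2 s_om) (w *m C)); last first.
  apply/funext => w; rewrite (_ : wedge om om = fun w => ev s_om2 (w *m C)); last exact/funext/om_omE.
  by rewrite omF -wedge_pullback ev_wedge.
rewrite etaF -wedge_pullback ev_wedge// (ev_same _ s_eta_om3) ev_scale; congr (_ * _).
by rewrite det_mono /s_vol ev_cons ev_nil addr0 mul1r.
Qed.

Variables (a b : R).
Hypotheses (a0 : a != 0) (b0 : b != 0).

Let D := C *m rescale a b.
Let Du : D \in unitmx.
Proof.
rewrite unitmx_mul Cu unitmxE det_diag unitfE; apply/prodf_neq0 => i _.
by rewrite mxE; case: ifP.
Qed.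

Definition g2_phi v := b ^+ 3 * re v + a * b ^+ 2 * wedge eta om v.
Definition g2_metric := D *m D^T.
Definition g2_vol (v : 'M[R]_7) := a * b ^+ 6 / 6 * wedge eta (wedge (wedge om om) om) v.

Lemma g2_phiE v : g2_phi v = ev s_phi (v *m D).
Proof.
rewrite /D mulmxA /s_phi ev_cat (ev_rescale (z := 0))// (ev_rescale (z := 1))//.
by rewrite /g2_phi reE eta_omE expr0 mul1r expr1.
Qed.

Lemma g2_volE v : g2_vol v = \det (v *m D).
Proof.
rewrite /g2_vol eta_om3E /D mulmxA [in RHS]det_mulmx det_diag.
rewrite (_ : \prod_(i < 7) _ = a * b ^+ 6); last first.
  by rewrite !big_ord_recl big_ord0 !mxE/= !exprS expr0 !mulr1; ring.
by field.
Qed.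

Let volF : g2_vol = fun v => \det (v *m D). Proof. exact/funext/g2_volE. Qed.

Lemma star_g2_phi w :
  star g2_metric g2_vol g2_phi w = b ^+ 4 / 2 * wedge om om w - a * b ^+ 3 * wedge eta im w.
Proof.
have /andP[st sm] := star_s_phi.
rewrite volF (_ : g2_phi = fun v => ev s_phi (v *m D)); last exact/funext/g2_phiE.
rewrite star_ev//; have := ev_same (w *m D) sm; rewrite ev_scale => /(canRL (mulKf _)) ->; last first.
  by rewrite intr_eq0.
rewrite /D mulmxA /s_psi2 ev_cat ev_scale (ev_rescale (z := 0))// (ev_rescale (z := 1))//.
by rewrite om_omE eta_imE; field.
Qed.

Lemma star_g2_psi w :
  star g2_metric g2_vol (fun v => b ^+ 4 / 2 * wedge om om v - a * b ^+ 3 * wedge eta im v) w = g2_phi w.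
Proof.
have /andP[st sm] := star_s_psi2.
rewrite volF (_ : (fun v => b ^+ 4 / 2 * _ - _) = fun v => 2^-1 * ev s_psi2 (v *m D)); last first.
  apply/funext => v; rewrite /D mulmxA /s_psi2 ev_cat ev_scale (ev_rescale (z := 0))// (ev_rescale (z := 1))//.
  by rewrite om_omE eta_imE; field.
by rewrite starZ star_ev// (ev_same _ sm) ev_scale g2_phiE; field.
Qed.

Let om_omD v : wedge om om v = b ^- 4 * ev s_om2 (v *m D).
Proof. by rewrite /D mulmxA (ev_rescale (z := 0))// om_omE expr0 mul1r mulKf// expf_neq0. Qed.

Lemma star_om_om c w :
  star g2_metric g2_vol (fun v => c * wedge om om v) w = c * (2 * a / b ^+ 2) * wedge eta om w.
Proof.
have /andP[st sm] := star_s_om2.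
rewrite volF (_ : (fun v => c * _) = fun v => (c * b ^- 4) * ev s_om2 (v *m D)); last first.
  by apply/funext => v; rewrite om_omD mulrA.
rewrite starZ star_ev// (ev_same _ sm) ev_scale /D mulmxA (ev_rescale (z := 1))// eta_omE.
by field.
Qed.

(** With c = a b^2 the second factor is d phi, so the value is 7 tau_0. *)
Lemma star_phi_om_om c w :
  star (k := 7) g2_metric g2_vol (wedge g2_phi (fun v => c * wedge om om v)) w = c * 6 / b ^+ 4.
Proof.
have /andP[st sm] := star_s_vol.
rewrite volF (_ : wedge _ _ = fun v => (c * b ^- 4 * 6) * ev s_vol (v *m D)); last first.
  apply/funext => v; rewrite (_ : g2_phi = fun v => ev s_phi (v *m D)); last exact/funext/g2_phiE.
  (* The term [0 * 0] only gives the function the shape expected by [wedge_combr]. *)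
  rewrite (_ : (fun v => _ * _) = fun v => (c * b ^- 4) * ev s_om2 (v *m D) + 0 * 0); last first.
    by apply/funext => u; rewrite om_omD mulrA mul0r addr0.
  rewrite wedge_combr mul0r addr0 -[RHS]mulrA; congr (_ * _).
  by rewrite -(wedge_pullback (ev s_phi) (ev s_om2)) ev_wedge// (ev_same _ s_phi_om2) ev_scale.
rewrite starZ star_ev// (ev_same _ sm) ev_cons ev_nil /mono det_mx00.
by field.
Qed.

Lemma g2_vol_unit : g2_vol 1%:M ^+ 2 = \det g2_metric.
Proof. by rewrite g2_volE mul1mx expr2 -[X in _ * X](det_tr D) -det_mulmx. Qed.

(** Both sides are bilinear in [u] and [w]: in coframe components the left side is a sum over pairs
    of basis vectors, of which [s_phi_contract] leaves 6 vol on the diagonal. *)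
Lemma g2_compatible u w v :
  wedge (wedge (contract u g2_phi) (contract w g2_phi)) g2_phi v = 6 * inner g2_metric u w * g2_vol v.
Proof.
have phiF : g2_phi = fun v => ev s_phi (v *m D) by exact/funext/g2_phiE.
have cE u' : contract u' g2_phi = fun z => contract (u' *m D) (ev s_phi) (z *m D).
  apply/funext => z; rewrite phiF /contract; congr ev.
  exact: (@mul_col_mx R 1 2 7 7).
pose c i := @ev R 6 2 (scontract i s_phi).
have cs u' : contract u' (@ev R 6 3 s_phi) = fun z => \sum_(i < 7) u' 0 i * c i z.
  by apply/funext => z; rewrite contract_ev.
rewrite !cE phiF (_ : wedge _ _ = fun z : 'M[R]_(2 + 2, 7) =>
    wedge (contract (u *m D) (ev s_phi)) (contract (w *m D) (ev s_phi)) (z *m D)); last first.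
  by apply/funext => z; rewrite wedge_pullback.
rewrite -(wedge_pullback (wedge (contract (u *m D) (ev s_phi)) (contract (w *m D) (ev s_phi)))).
rewrite !cs; set u' := u *m D; set w' := w *m D; set v' := v *m D.
rewrite (_ : wedge _ _ = fun z => \sum_(p : 'I_7 * 'I_7) (u' 0 p.1 * w' 0 p.2) * wedge (c p.1) (c p.2) z); last first.
  apply/funext => z; rewrite wedge_suml -(pair_bigA _ (fun i j => u' 0 i * w' 0 j * wedge (c i) (c j) z))/=.
  by apply: eq_bigr => i _; rewrite wedge_sumr mulr_sumr; apply: eq_bigr => j _; rewrite mulrA.
rewrite wedge_suml.
have E (i j : 'I_7) : wedge (wedge (c i) (c j)) (ev s_phi) v' = if i == j then 6 * \det v' else 0.
  have im7 (m : 'I_7) : val m \in iota 0 7 by rewrite mem_iota ltn_ord.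
  have /and3P[d2 d4 sm] := allP (allP s_phi_contract _ (im7 i)) _ (im7 j).
  rewrite (_ : wedge (c i) (c j) = ev (swedge (scontract i s_phi) (scontract j s_phi))); last first.
    by apply/funext => z; rewrite ev_wedge.
  rewrite ev_wedge// (ev_same _ sm) val_eqE; case: (i == j); last by rewrite ev_nil.
  by rewrite ev_scale det_mono /s_vol ev_cons ev_nil addr0 mul1r.
under eq_bigr do rewrite E.
rewrite -(pair_bigA _ (fun i j => u' 0 i * w' 0 j * (if i == j then 6 * \det v' else 0)))/=.
rewrite g2_volE /inner /g2_metric -/v'.
rewrite (_ : u *m (D *m D^T) *m w^T = u' *m w'^T); last by rewrite /u' /w' (trmx_mul w D) !mulmxA.
rewrite mxE mulr_sumr mulr_suml; apply: eq_bigr => i _.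
rewrite (bigD1 i)//= eqxx big1 ?addr0; last by move=> j /negbTE; rewrite eq_sym => ->; rewrite mulr0.
have -> : w'^T i 0 = w' 0 i by rewrite [LHS]mxE.
by ring.
Qed.

Lemma posdef_g2_metric : posdef g2_metric.
Proof.
split; first by rewrite /g2_metric trmx_mul trmxK.
move=> u u0; rewrite /inner /g2_metric mulmxA -mulmxA -(trmx_mul u D) mxE.
have [i ui] : exists i, (u *m D) 0 i != 0.
  by apply/rV0Pn; apply: contra u0 => /eqP uD; rewrite -(mulmxK Du u) uD mul0mx.
under eq_bigr => j _ do rewrite [X in _ * X](mxE _ _ j) -expr2.
rewrite (bigD1 i)//= ltr_pwDl//; first by rewrite exprn_even_gt0.
by apply: sumr_ge0 => j _; rewrite sqr_ge0.
Qed.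

(** The coframe drops out because its first covector is [eta] and only that direction scales by [a]
    instead of [b]. *)
Lemma g2_metricE (gm : 'M[R]_7) : C *m C^T = model_metric gm eta ->
  g2_metric = b ^+ 2 *: model_metric gm eta +
    (a ^+ 2 - b ^+ 2) *: ((\col_i eta (delta_mx 0 i)) *m (\row_i eta (delta_mx 0 i))).
Proof.
move=> CC; rewrite -CC; apply/matrixP => i j.
have e0 m : eta (delta_mx 0 m) = C m 0.
  by rewrite etaE /s_eta ev_cons ev_nil addr0 mul1r /mono det_mx11 mxE/= -rowE mxE; congr (C m _); apply: val_inj; rewrite /= inordK.
rewrite /g2_metric /D /rescale mul_mx_diag !mxE big_ord1 !mxE !e0 mulr_sumr.
rewrite (bigD1 0)//= [in RHS](bigD1 0)//= !mxE eqxx -addrA [X in _ = _ + X]addrC addrA.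
congr (_ + _); first by ring.
by apply: eq_bigr => k /negbTE k0; rewrite !mxE k0; ring.
Qed.

Lemma alternating_g2_phi : alternating g2_phi.
Proof.
rewrite (_ : g2_phi = fun v => ev s_phi (v *m D)); last exact/funext/g2_phiE.
exact/alternating_pullback/alternating_ev.
Qed.

Lemma alternating_g2_vol : alternating g2_vol.
Proof. by rewrite volF; exact: alternating_det. Qed.

End PointwiseG2.

(** * Forms in a chart, the cone and the fundamental form *)

Section LocalGeometry.
Context {R : realType}.

Lemma alternating_extd n k (U : set 'rV[R]_n.+1) (a : lform R n.+1 k) x : open U -> U x ->
  (forall y, U y -> alternating (a y)) ->
  (forall w, differentiable (fun y => a y w : R^o) x) -> alternating (extd a x).
Proof.
move=> oU Ux aalt da; rewrite (_ : extd a x = fun v =>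
    \sum_(p : {ffun 'I_k -> 'I_n.+1} * 'I_n.+1)
      'D_(delta_mx 0 p.2) (coef a p.1) x * mono (val p.2 :: seqf p.1) v); last first.
  by apply/funext => v; rewrite (extd_coef oU Ux)// pair_bigA.
apply: alternating_sum => p; exact/alternatingZ/alternating_mono.
Qed.

Lemma smoothZ n (W : normedModType R) (U : set 'rV[R]_n) (c : R) (f : 'rV[R]_n -> W) :
  open U -> smooth_on U f -> smooth_on U (fun x => c *: f x).
Proof.
move=> oU /smooth_ck fs; apply/smooth_ck => m; elim: m f {fs}(fs m) => [|m IH] f fck.
  by split=> // x Ux; apply: differentiableZ; exact: ck_differentiable fck _ Ux.
split=> [x Ux|v]; first by apply: differentiableZ; exact: ck_differentiable fck _ Ux.
apply: (eq_ck oU) (IH _ (fck.2 v)) => x Ux.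
by rewrite [RHS]deriveZ//; apply: diff_derivable; exact: ck_differentiable fck _ Ux.
Qed.

Lemma inner_congr n p (J : 'M[R]_(p, n)) (A : 'M[R]_n) u w :
  inner (J *m A *m J^T) u w = inner A (u *m J) (w *m J).
Proof. by rewrite /inner trmx_mul !mulmxA. Qed.

Lemma inner_inj n (A B : 'M[R]_n) : (forall u w, inner A u w = inner B u w) -> A = B.
Proof.
move=> AB; apply/matrixP => i j; have := AB (delta_mx 0 i) (delta_mx 0 j).
by rewrite /inner -!rowE trmx_delta -!colE !mxE.
Qed.

(* The vectors tangent to the slice [r = 1] of the cone see the form
   [g (Phi ., .)], whose exterior derivative along the slice therefore vanishes. *)
Lemma cone_form_closed n (U : set 'rV[R]_n) (g Phi : lendo n) (xi : lvfield n) (eta : lform R n 1) :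
  kahler_on (cone_dom U) (cone_metric g) (cone_cpx xi eta Phi) ->
  forall x, U x -> forall v,
  extd (fun y (w : 'M[R]_(2, n)) => inner (g y) (row 0 w *m Phi y) (row 1 w)) x v = 0.
Proof.
move=> K x Ux v; pose y : 'rV[R]_(1 + n) := row_mx 1%:M x.
have Uy : cone_dom U y by rewrite /cone_dom/= row_mxKl row_mxKr mxE eqxx; split.
rewrite -[RHS](kahler_closed K Uy (row_mx 0 v)) /extd; apply: eq_bigr => j _; congr (_ * _).
have -> : row j (row_mx (0 : 'M[R]_(3, 1)) v) = row_mx 0 (row j v).
  by apply/rowP => m; rewrite !mxE; case: (fintype.split m) => m'; rewrite !mxE.
have E (u : 'rV[R]_n) : inner (g u) (row 0 (row' j v) *m Phi u) (row 1 (row' j v)) =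
    inner (cone_metric g (row_mx 1%:M u))
      (row 0 (row' j (row_mx (0 : 'M[R]_(3, 1)) v)) *m cone_cpx xi eta Phi (row_mx 1%:M u))
      (row 1 (row' j (row_mx (0 : 'M[R]_(3, 1)) v))).
  have rE i : row i (row' j (row_mx (0 : 'M[R]_(3, 1)) v)) = row_mx 0 (row i (row' j v)).
    by apply/rowP => m; rewrite !mxE; case: (fintype.split m) => m'; rewrite !mxE.
  rewrite !rE /cone_cpx/cone_metric !row_mxKl !row_mxKr mxE eqxx expr1n scale1r.
  rewrite mul_row_block !mul0mx !add0r /inner mul_row_block tr_row_mx mul_row_col.
  by rewrite trmx0 !mulmx0 !add0r.
set F1 := (X in 'D_(row j v) X x); set F2 := (X in _ = 'D_(row_mx 0 (row j v)) X y).
(* Moving along the slice keeps r = 1, so the difference quotients themselves agree. *)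
rewrite /derive; suff -> : (fun h => h^-1 *: ((F2 \o shift y) (h *: row_mx 0 (row j v)) - F2 y)) =
  (fun h => h^-1 *: ((F1 \o shift x) (h *: row j v) - F1 x)) by [].
apply/funext => h /=; rewrite /F1 !E /F2 /y scale_row_mx scaler0.
by rewrite add_row_mx add0r.
Qed.

End LocalGeometry.

(** The compatibility prescribes [o] only when the second argument is in the image of Phi. Writing w
    = - Phi^2 w + eta(w) xi reaches every [w] once [xi] is known to lie in the kernel of [o]; the
    same splitting proves that too. *)
Lemma fundamental_form (R : realType) (g Phi : 'M[R]_7) (xi : 'rV[R]_7) (eta : 'rV[R]_7 -> R)
    (o : 'M[R]_(1 + 1, 7) -> R) : almost_contact g Phi xi eta -> alternating o ->
  (forall u w, inner g u w =
     2^-1 * o (col_mx u (w *m Phi) : 'M[R]_(1 + 1, 7)) + eta u * eta w) ->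
  forall v, o v = -2 * inner g (row 0 v) (row 1 v *m Phi).
Proof.
move=> acm oalt compat v; pose c u w := contract u o w.
have oP u w : c u (w *m Phi) = 2 * (inner g u w - eta u * eta w).
  by rewrite compat /c /contract; field.
have cr u s t w w' : c u (s *: w + t *: w') = s * c u w + t * c u w'.
  apply: ((alternating_contract u oalt).1 _ _ _ 0); first by rewrite !row_id.
  by move=> j; rewrite (ord1 j) eqxx.
have c0 u : c u u = 0.
  apply: (oalt.2 _ (@lshift 1 1 0) (@rshift 1 1 0)); first by [].
  by rewrite rowKu rowKd.
have cC u w : c u w = - c w u.
  have := c0 (1 *: u + 1 *: w); rewrite cr /c !contractDl// -/(c _ _) -/(c _ _) -/(c _ _) -/(c _ _) !c0.
  by rewrite !mul1r add0r addr0 addrC => /eqP; rewrite addr_eq0 => /eqP.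
have split_Phi w : w = -1 *: (w *m Phi *m Phi) + eta w *: xi.
  by rewrite (acm_Phi2 acm) scalerDr !scaleN1r opprK -addrA addNr addr0.
have xi0 u : c xi u = 0.
  rewrite [u]split_Phi cr oP c0 (eta_Phi acm) (innerC _ _ (acm_pos acm).1).
  by rewrite (inner_xi acm) (eta_Phi acm); ring.
have -> : o v = c (row 0 v) (row 1 v).
  rewrite /c /contract; congr (o _); apply/row_matrixP => a.
  case: (split_ordP a) => a' ->; rewrite (ord1 a').
    by rewrite rowKu row_id; congr row; apply: val_inj.
  by rewrite rowKd row_id; congr row; apply: val_inj.
rewrite [X in c _ X]split_Phi cr oP [c _ xi]cC xi0 (eta_Phi acm); ring.
Qed.

(** * Contact Calabi-Yau manifolds *)

Section ContactCalabiYau.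
Context {R : realType} {M : manifold R 7}.
Variables (xi : vfield M) (eta : dform M R 1) (Phi g : endo M) (Ups : dform M R[i] 3).
Hypothesis hCY : contact_calabi_yau xi eta Phi g Ups.
Hypothesis hnorm : is_Upsilon_norm eta Ups (fun=> 1).

Let sas : sasakian xi eta Phi g. Proof. by case: hCY. Qed.

Local Notation om i x := (extd (eta i) x).

Lemma open_cimg (i : chart M) : open (cimg i).
Proof. by rewrite /cimg; case: M i. Qed.

Let eta_smooth i v : smooth_on (cimg i) (fun x => eta i x v : R^o).
Proof. by have [] := sas_eta sas. Qed.

Let eta_alt i x : cimg i x -> alternating (eta i x).
Proof. by have [_ + _] := sas_eta sas; exact. Qed.

Let om_smooth i v : smooth_on (cimg i) (fun x => om i x v : R^o).
Proof. by apply: smooth_extd => [|w]; [exact: open_cimg|exact: eta_smooth]. Qed.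

Let om_alt i x : cimg i x -> alternating (om i x).
Proof.
move=> Ux; apply: (alternating_extd (@open_cimg i) Ux) => [y|w]; first exact: eta_alt.
exact: (smooth_differentiable (@eta_smooth i w) Ux).
Qed.

Lemma almost_contact_at i x : cimg i x ->
  almost_contact (g i x) (Phi i x) (xi i x) (eta i x).
Proof.
move=> Ux; split.
- by have [_ + _] := sas_g sas; exact.
- move=> c d u w; apply: ((eta_alt Ux).1 _ _ _ 0); first by rewrite !row_id.
  by move=> j; rewrite (ord1 j) eqxx.
- exact: sas_eta_xi sas _ _ Ux.
- exact: sas_Phi2 sas _ _ Ux.
- exact: sas_compatible sas _ _ Ux.
Qed.

Lemma deta_E i x : cimg i x ->
  forall v, om i x v = -2 * inner (g i x) (row 0 v) (row 1 v *m Phi i x).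
Proof.
move=> Ux; apply: (fundamental_form (almost_contact_at Ux) (om_alt Ux)).
exact: sas_metric sas _ _ Ux.
Qed.

Lemma coframe_at i x : cimg i x -> exists C : 'M[R]_7,
  [/\ C \in unitmx, C *m C^T = model_metric (g i x) (eta i x),
      forall v, eta i x v = ev s_eta (v *m C),
      forall v, om i x v = ev s_om (v *m C)
    & (forall v, re_form Ups i x v = ev s_re (v *m C)) /\
      (forall v, im_form Ups i x v = ev s_im (v *m C))].
Proof.
move=> Ux; have [p dp px] := Ux.
apply: (exists_coframe (almost_contact_at Ux) (deta_E Ux)).
- by have [_ + _] := ccy_re_form hCY; exact.
- by have [_ + _] := ccy_im_form hCY; exact.
- by have [] := ccy_re_basic hCY Ux.
- by have [] := ccy_im_basic hCY Ux.
- by move=> u eu w; exact: (ccy_type hCY Ux).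
- by move=> v; have := hnorm.2 i p dp v; rewrite /= px.
Qed.

(* d (d eta) = 0 is read off the closedness of the Kähler form of the cone. *)
Lemma deta_closed i x : cimg i x -> forall v, extd (fun y => om i y) x v = 0.
Proof.
move=> Ux v; have dom w : differentiable (fun y => om i y w : R^o) x.
  exact: (smooth_differentiable (@om_smooth i w) Ux).
have := cone_form_closed (sas_cone sas i) Ux v.
rewrite (eq_extd (b := fun y w => 2^-1 * om i y w) _ (@open_cimg i) Ux) ?extdZ//.
  by move=> /eqP; rewrite mulf_eq0 invr_eq0 pnatr_eq0/= => /eqP.
by move=> y Uy w; rewrite (deta_E Uy) (inner_skew (almost_contact_at Uy)); field.
Qed.

Lemma extd_eta_wedge_deta i x v : cimg i x ->
  extd (fun y => wedge (eta i y) (om i y)) x v = wedge (om i x) (om i x) v.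
Proof.
move=> Ux; apply: (extd_wedge_closed (@open_cimg i) Ux) => //.
- exact: eta_alt.
- exact: om_alt.
- by move=> w; exact: (smooth_differentiable (@eta_smooth i w) Ux).
- by move=> w; exact: (smooth_differentiable (@om_smooth i w) Ux).
- exact: deta_closed.
Qed.

Lemma wedge0l k l n (b : 'M[R]_(l, n) -> R) v : wedge (fun _ : 'M[R]_(k, n) => 0) b v = 0.
Proof. by rewrite /wedge big1 ?mulr0// => s _; rewrite mulr0 mul0r. Qed.

Lemma extd_deta_wedge_deta i x v : cimg i x ->
  extd (fun y => wedge (om i y) (om i y)) x v = 0.
Proof.
move=> Ux; rewrite (extd_wedge_closed (@open_cimg i) Ux).
- by rewrite (_ : extd _ x = fun=> 0) ?wedge0l//; apply/funext; exact: deta_closed.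
- exact: om_alt.
- exact: om_alt.
- by move=> w; exact: (smooth_differentiable (@om_smooth i w) Ux).
- by move=> w; exact: (smooth_differentiable (@om_smooth i w) Ux).
- exact: deta_closed.
Qed.

Let re_smooth i v : smooth_on (cimg i) (fun x => re_form Ups i x v : R^o).
Proof. by have [] := ccy_re_form hCY. Qed.

Let im_smooth i v : smooth_on (cimg i) (fun x => im_form Ups i x v : R^o).
Proof. by have [] := ccy_im_form hCY. Qed.

Lemma extd_eta_wedge_im i x v : cimg i x ->
  extd (fun y => wedge (eta i y) (im_form Ups i y)) x v = 0.
Proof.
move=> Ux; rewrite (extd_wedge_closed (@open_cimg i) Ux).
- by have [C [_ _ _ omE [_ imE]]] := coframe_at Ux; exact: (wedge_om_im omE imE).
- exact: eta_alt.
- by have [_ + _] := ccy_im_form hCY; exact.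
- by move=> w; exact: (smooth_differentiable (@eta_smooth i w) Ux).
- by move=> w; exact: (smooth_differentiable (@im_smooth i w) Ux).
- by move=> w; exact: (ccy_im_closed hCY Ux).
Qed.

Section Rescaled.
Variables (a b : R).
Hypotheses (a0 : a != 0) (b0 : b != 0).

Definition ccy_phi : dform M R 3 :=
  fun i x v => b ^+ 3 * re_form Ups i x v + a * b ^+ 2 * wedge (eta i x) (om i x) v.

Definition ccy_metric : endo M := fun i x =>
  b ^+ 2 *: model_metric (g i x) (eta i x) + (a ^+ 2 - b ^+ 2) *:
    ((\col_j eta i x (delta_mx 0 j)) *m (\row_j eta i x (delta_mx 0 j))).

Definition ccy_vol : dform M R 7 := fun i x => g2_vol (eta i x) (om i x) a b.

Definition ccy_psi i (x : 'rV[R]_7) (w : 'M[R]_(4, 7)) : R :=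
  b ^+ 4 / 2 * wedge (om i x) (om i x) w - a * b ^+ 3 * wedge (eta i x) (im_form Ups i x) w.

Lemma dual_ccy_phi i x w : cimg i x ->
  G2_dual ccy_metric ccy_vol ccy_phi i x w = ccy_psi i x w.
Proof.
move=> Ux; have [C [Cu CC etaE omE [reE imE]]] := coframe_at Ux.
have := star_g2_phi Cu etaE omE reE imE a0 b0 w.
by rewrite (g2_metricE etaE a b CC).
Qed.

Let wedge_om_om_smooth i v : smooth_on (cimg i) (fun x => wedge (om i x) (om i x) v : R^o).
Proof. by apply: smooth_wedge => [|w|w]; [exact: open_cimg|exact: om_smooth|exact: om_smooth]. Qed.

Let wedge_eta_om_smooth i v : smooth_on (cimg i) (fun x => wedge (eta i x) (om i x) v : R^o).
Proof. by apply: smooth_wedge => [|w|w]; [exact: open_cimg|exact: eta_smooth|exact: om_smooth]. Qed.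

Let wedge_eta_im_smooth i v : smooth_on (cimg i) (fun x => wedge (eta i x) (im_form Ups i x) v : R^o).
Proof. by apply: smooth_wedge => [|w|w]; [exact: open_cimg|exact: eta_smooth|exact: im_smooth]. Qed.

Let ccy_phi_smooth i v : smooth_on (cimg i) (fun x => ccy_phi i x v : R^o).
Proof.
have oU := @open_cimg i.
by apply: (smoothD oU); apply: (smoothM oU) => //; exact: smooth_cst.
Qed.

Lemma extd_ccy_phi i x v : cimg i x ->
  extd (ccy_phi i) x v = a * b ^+ 2 * wedge (om i x) (om i x) v.
Proof.
move=> Ux; rewrite [LHS]extd_comb.
- by rewrite (ccy_re_closed hCY Ux) extd_eta_wedge_deta// mulr0 add0r.
- by move=> w; exact: (smooth_differentiable (@re_smooth i w) Ux).
- by move=> w; exact: (smooth_differentiable (@wedge_eta_om_smooth i w) Ux).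
Qed.

Lemma extd_ccy_psi i x v : cimg i x -> extd (ccy_psi i) x v = 0.
Proof.
move=> Ux; rewrite (_ : ccy_psi i = fun y w => b ^+ 4 / 2 * wedge (om i y) (om i y) w
    + (- (a * b ^+ 3)) * wedge (eta i y) (im_form Ups i y) w); last first.
  by apply/funext => y; apply/funext => w; rewrite mulNr.
rewrite extd_comb.
- by rewrite extd_deta_wedge_deta// extd_eta_wedge_im// !mulr0 addr0.
- by move=> w; exact: (smooth_differentiable (@wedge_om_om_smooth i w) Ux).
- by move=> w; exact: (smooth_differentiable (@wedge_eta_im_smooth i w) Ux).
Qed.

Lemma star_ccy_psi i x w : cimg i x ->
  star (ccy_metric i x) (ccy_vol i x) (ccy_psi i x) w = ccy_phi i x w.
Proof.
move=> Ux; have [C [Cu CC etaE omE [reE imE]]] := coframe_at Ux.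
have := star_g2_psi Cu etaE omE reE imE a0 b0 w.
by rewrite (g2_metricE etaE a b CC).
Qed.

Lemma codiff_ccy_psi i x w : cimg i x ->
  codiff (ccy_metric i) (ccy_vol i) (ccy_psi i) x w = 2 * a ^+ 2 * wedge (eta i x) (om i x) w.
Proof.
(* The exponent is 7 * 5 + 1 = 36, so the codifferential is star d star, and the inner star turns
   psi back into phi. *)
move=> Ux; rewrite /codiff (_ : (-1) ^+ _ = 1); last by rewrite -signr_odd.
rewrite mul1r.
rewrite (_ : extd (fun y => star (ccy_metric i y) (ccy_vol i y) (ccy_psi i y)) x =
    fun v => a * b ^+ 2 * wedge (om i x) (om i x) v); last first.
  apply/funext => v; rewrite (eq_extd (b := ccy_phi i) _ (@open_cimg i) Ux) ?extd_ccy_phi//.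
  by move=> y Uy u; exact: star_ccy_psi.
have [C [Cu CC etaE omE [reE imE]]] := coframe_at Ux.
have := star_om_om Cu etaE omE a0 b0 (a * b ^+ 2) w.
by rewrite (g2_metricE etaE a b CC) => ->; field.
Qed.

Lemma tau0_ccy_phi i x : cimg i x ->
  tau0 ccy_metric ccy_vol ccy_phi i x = 6 * a / (7 * b ^+ 2).
Proof.
move=> Ux; rewrite /tau0 (_ : extd (ccy_phi i) x = fun v => a * b ^+ 2 * wedge (om i x) (om i x) v); last first.
  by apply/funext => v; exact: extd_ccy_phi.
have [C [Cu CC etaE omE [reE imE]]] := coframe_at Ux.
have := star_phi_om_om Cu etaE omE reE a0 b0 (a * b ^+ 2) 0.
by rewrite (g2_metricE etaE a b CC) => ->; field.
Qed.

Lemma coflow_rhs_ccy i x v : cimg i x ->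
  hodge_laplacian (ccy_metric i) (ccy_vol i) (G2_dual ccy_metric ccy_vol ccy_phi i) x v +
  extd (fun y w => (0 - 7 / 2 * tau0 ccy_metric ccy_vol ccy_phi i y) * ccy_phi i y w) x v =
  - a ^+ 2 * wedge (om i x) (om i x) v.
Proof.
move=> Ux; have oU := @open_cimg i.
(* [G2_dual] and [ccy_psi] agree only on the chart image, so they are exchanged under d by
   locality. *)
have cod y w : cimg i y -> codiff (ccy_metric i) (ccy_vol i) (G2_dual ccy_metric ccy_vol ccy_phi i) y w =
    codiff (ccy_metric i) (ccy_vol i) (ccy_psi i) y w.
  move=> Uy; rewrite /codiff; congr (_ * _).
  rewrite (_ : extd _ y = extd (fun z => star (ccy_metric i z) (ccy_vol i z) (ccy_psi i z)) y)//.
  apply/funext => u; apply: (eq_extd _ oU Uy) => z Uz s.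
  by congr (star _ _ _ s); apply/funext => r; exact: dual_ccy_phi.
have star0 k (G : 'M[R]_7) vol w : star G vol (fun _ : 'M[R]_(k, 7) => 0) w = 0.
  by rewrite /star big1 ?mulr0// => f _; rewrite mul0r.
have dpsi y : cimg i y -> extd (G2_dual ccy_metric ccy_vol ccy_phi i) y = fun=> 0.
  move=> Uy; apply/funext => u; rewrite (eq_extd (b := ccy_psi i) _ oU Uy) ?extd_ccy_psi//.
  by move=> z Uz s; exact: dual_ccy_phi.
(* As d psi = 0, only d applied to the codifferential of psi is left of the Laplacian; it equals 2
   a^2 d (eta omega). *)
rewrite /hodge_laplacian [X in _ + X + _](_ : _ = 0); last first.
  rewrite /codiff (_ : extd _ x = fun=> 0) ?star0 ?mulr0//.
  apply/funext => u; rewrite (eq_extd (b := fun _ _ => 0) _ oU Ux) ?extd0// => z Uz s.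
  by rewrite dpsi// star0.
rewrite addr0 (eq_extd (b := fun y w => 2 * a ^+ 2 * wedge (eta i y) (om i y) w) _ oU Ux); last first.
  by move=> y Uy w; rewrite cod// codiff_ccy_psi.
rewrite extdZ; last by move=> w; exact: (smooth_differentiable (@wedge_eta_om_smooth i w) Ux).
(* As tau_0 is constant on M, its term is -(3 a / b^2) d phi = -3 a^2 omega^2; the Laplacian
   contributes 2 a^2 omega^2. *)
rewrite [X in _ + X](eq_extd (b := fun y w => (- (3 * a / b ^+ 2)) * ccy_phi i y w) _ oU Ux); last first.
  by move=> y Uy w; rewrite tau0_ccy_phi//; congr (_ * _); field.
rewrite (@extdZ R 7 3 (ccy_phi i)); last by move=> w; exact: (smooth_differentiable (@ccy_phi_smooth i w) Ux).
by rewrite extd_eta_wedge_deta// extd_ccy_phi//; field.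
Qed.

Let coord_cimg (i : chart M) (p : M) : dom i p -> cimg i (coord i p).
Proof. by move=> dp; exists p. Qed.

(* [deta_E] expresses d eta through the tensors g and Phi, so that its naturality under
   changes of charts needs no symmetry of second derivatives. *)
Lemma deta_transform (i j : chart M) (p : M) v : dom i p -> dom j p ->
  om i (coord i p) v = om j (coord j p) (v *m jac i j p).
Proof.
move=> di dj; rewrite (deta_E (coord_cimg di)) (deta_E (coord_cimg dj)); congr (_ * _).
have [_ _ gT] := sas_g sas; have [_ PhiT] := sas_Phi sas.
by rewrite (gT i j p di dj) inner_congr !row_mul -!mulmxA (PhiT i j p di dj).
Qed.

Lemma inner_ccy_metric i x u w : cimg i x -> inner (ccy_metric i x) u w =
  b ^+ 2 * (2 * inner (g i x) u w - eta i x u * eta i x w) + (a ^+ 2 - b ^+ 2) * (eta i x u * eta i x w).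
Proof.
move=> Ux; rewrite -(inner_model (almost_contact_at Ux)) -(inner_eta2 (almost_contact_at Ux)).
by rewrite /inner /ccy_metric mulmxDr mulmxDl -!scalemxAr -!scalemxAl !mxE.
Qed.

Lemma ccy_metric_smooth i : smooth_on (cimg i) (ccy_metric i).
Proof.
have oU := @open_cimg i; have [gs _ _] := sas_g sas.
(* Expanding in elementary matrices reduces a matrix-valued product to products of real
   functions. *)
have os : smooth_on (cimg i) (fun x => (\col_j eta i x (delta_mx 0 j)) *m (\row_j eta i x (delta_mx 0 j))).
  apply: (eq_smooth oU (f := fun x => \sum_k \sum_l (eta i x (delta_mx 0 k) * eta i x (delta_mx 0 l)) *: delta_mx k l)).
    move=> x Ux; rewrite [RHS]matrix_sum_delta; apply: eq_bigr => k _; apply: eq_bigr => l _.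
    by rewrite !mxE big_ord1 !mxE.
  apply: (smooth_sum oU) => k _; apply: (smooth_sum oU) => l _; apply: (smoothZl oU).
  by apply: (smoothM oU).
apply: (smoothD oU); last exact: smoothZ.
apply: smoothZ => //; rewrite /model_metric.
apply: (eq_smooth oU (f := fun x => 2 *: g i x + (-1) *: ((\col_j eta i x (delta_mx 0 j)) *m (\row_j eta i x (delta_mx 0 j))))).
  by move=> x Ux; rewrite scaleN1r.
by apply: (smoothD oU); exact: smoothZ.
Qed.

(** The pointwise clauses are read in a coframe; smoothness and the transformation laws come from
    the expressions in [eta], [g] and [Ups]. *)
Lemma G2_structure_ccy : G2_structure ccy_phi ccy_metric ccy_vol.
Proof.
have [_ _ etaT] := sas_eta sas; have [_ _ gT] := sas_g sas.
have [_ _ reT] := ccy_re_form hCY.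
have etaJ (i j : chart M) (p : M) : dom i p -> dom j p -> eta i (coord i p) = fun v => eta j (coord j p) (v *m jac i j p).
  by move=> di dj; apply/funext => v; exact: etaT.
have omJ (i j : chart M) (p : M) : dom i p -> dom j p -> om i (coord i p) = fun v => om j (coord j p) (v *m jac i j p).
  by move=> di dj; apply/funext => v; exact: deta_transform.
split.
- split; first exact: ccy_phi_smooth.
    move=> i x Ux; have [C [Cu CC etaE omE [reE imE]]] := coframe_at Ux.
    exact: (alternating_g2_phi etaE omE reE a b).
  move=> i j p di dj v; rewrite /ccy_phi (reT i j p di dj) (etaJ i j p di dj) (omJ i j p di dj).
  by rewrite [in RHS]wedge_pullback.
- split; first exact: ccy_metric_smooth.
    move=> i x Ux; have [C [Cu CC etaE omE [reE imE]]] := coframe_at Ux.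
    by rewrite /ccy_metric -(g2_metricE etaE a b CC); exact: posdef_g2_metric.
  move=> i j p di dj; apply: inner_inj => u w; rewrite inner_congr.
  rewrite !inner_ccy_metric; [|exact: coord_cimg..].
  by rewrite (gT i j p di dj) inner_congr !(etaT i j p di dj).
- split.
  + move=> i v; have oU := @open_cimg i; apply: (smoothM oU); first exact: smooth_cst.
    by do 3?[apply: (smooth_wedge oU) => // ?].
  + move=> i x Ux; have [C [Cu CC etaE omE [reE imE]]] := coframe_at Ux.
    exact: (alternating_g2_vol etaE omE a b).
  + move=> i j p di dj v; rewrite /ccy_vol /g2_vol; congr (_ * _).
    have om2 : wedge (om i (coord i p)) (om i (coord i p)) =
        fun w => wedge (om j (coord j p)) (om j (coord j p)) (w *m jac i j p).
      by apply/funext => w; rewrite (omJ i j p di dj); exact/esym/wedge_pullback.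
    have om3 : wedge (wedge (om i (coord i p)) (om i (coord i p))) (om i (coord i p)) =
        fun w => wedge (wedge (om j (coord j p)) (om j (coord j p))) (om j (coord j p)) (w *m jac i j p).
      by apply/funext => w; rewrite om2 (omJ i j p di dj); exact/esym/wedge_pullback.
    by rewrite om3 (etaJ i j p di dj); exact/esym/wedge_pullback.
- move=> i x Ux; have [C [Cu CC etaE omE [reE imE]]] := coframe_at Ux.
  by rewrite /ccy_metric -(g2_metricE etaE a b CC); exact: g2_vol_unit.
- move=> i x Ux u w v; have [C [Cu CC etaE omE [reE imE]]] := coframe_at Ux.
  by rewrite /ccy_metric -(g2_metricE etaE a b CC); exact: g2_compatible.
Qed.

End Rescaled.
End ContactCalabiYau.

(** * Time derivative and conclusion *)

Section TimeDerivative.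
Context {R : realType}.

(** A two-sided derivative restricts to any [D]. This covers the one-sided quotient at t = 0, where
    the powers of 1 - c s are differentiable from both sides. *)
Lemma is_derive_slope (f : R -> R^o) (t l : R) (D : set R) : is_derive t 1 f l ->
  (fun s => (s - t)^-1 * (f s - f t)) @ within D t^' --> l.
Proof.
move=> [/cvg_ex[/= l' fl] <-]; rewrite /derive (cvg_lim _ fl)//.
move: fl => /cvgrPdist_lt fl; apply/cvgrPdist_lt => e e0.
have := fl e e0; rewrite /dnbhs !near_withinE => fle.
suff : \forall s \near t, s != t -> `|l' - (s - t)^-1 * (f s - f t)| < e.
  by apply: filterS => s H st _; exact: H.
rewrite (near_shift 0 t); apply: filterS fle => h /= H ht.
have h0 : h != 0 by apply: contra ht => /eqP ->; rewrite add0r subr0.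
by have := H h0; rewrite /= /GRing.scale/= mulr1 subr0 addrK.
Qed.

Lemma is_derive_powR_affine (c r t : R) : 0 < 1 - c * t ->
  is_derive t 1 (fun s => (1 - c * s) `^ r : R^o) (- c * r * (1 - c * t) `^ (r - 1)).
Proof.
move=> u0; have dg : is_derive t 1 (fun s : R => 1 - c * s : R^o) (- c).
  rewrite (_ : (fun s => _) = cst 1 - c \*: (id : R -> R^o)); last by apply/funext.
  apply: is_derive_eq; by rewrite sub0r /GRing.scale/= mulr1.
apply: is_derive_eq (@is_derive1_comp _ (@powR R ^~ r) (fun s => 1 - c * s) t _ _ (is_derive1_powR r u0) dg) _.
by rewrite mulrC; ring.
Qed.

End TimeDerivative.

Theorem corollary4p3 (R : realType) (M : manifold R 7)
    (xi : vfield M) (eta : dform M R 1) (Phi g : endo M) (Ups : dform M R[i] 3)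
    (hCY : contact_calabi_yau xi eta Phi g Ups)
    (hflat : transverse_ricci_flat xi eta g)
    (hnorm : is_Upsilon_norm eta Ups (fun=> 1))
    (eps : R) (heps : 0 < eps) :
  let a (t : R) := eps * (1 - 5 * eps ^+ 2 * t) `^ (- (3 / 10)) in
  let b (t : R) := (1 - 5 * eps ^+ 2 * t) `^ (1 / 10) in
  modified_laplacian_coflow 0 (1 / (5 * eps ^+ 2))
    (fun t i x v => b t ^+ 3 * re_form Ups i x v +
                    a t * b t ^+ 2 * wedge (eta i x) (extd (eta i) x) v).
Proof.
move=> a b; set c := 5 * eps ^+ 2.
have c0 : 0 < c by rewrite mulr_gt0// exprn_gt0.
have u_gt0 t : 0 <= t < 1 / c -> 0 < 1 - c * t.
  by move=> /andP[_]; rewrite ltr_pdivlMr// mulrC subr_gt0.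
have a_neq0 t : 0 <= t < 1 / c -> a t != 0.
  by move=> /u_gt0 u0; rewrite gt_eqF// mulr_gt0// powR_gt0.
have b_neq0 t : 0 <= t < 1 / c -> b t != 0.
  by move=> /u_gt0 u0; rewrite gt_eqF// powR_gt0.
have bX t n : 0 <= t < 1 / c -> b t ^+ n = (1 - c * t) `^ (n%:R / 10).
  by move=> /u_gt0 u0; rewrite -powR_mulrn ?powR_ge0// -powRrM; congr powR; field.
have ab3 t : 0 <= t < 1 / c -> a t * b t ^+ 3 = eps.
  move=> tT; have u0 := u_gt0 t tT; rewrite bX// /a -mulrA -powRD ?addNr ?powRr0 ?mulr1//.
  by rewrite eqxx /= gt_eqF.
(* The exponent -6/10 is written 4/10 - 1 to match the one left by differentiating b^4. *)
have a2 t : 0 <= t < 1 / c -> a t ^+ 2 = eps ^+ 2 * (1 - c * t) `^ (4 / 10 - 1).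
  by move=> /u_gt0 u0; rewrite /a exprMn -[X in _ * X = _]powR_mulrn ?powR_ge0// -powRrM; congr (_ * powR _ _); field.
exists (fun t => ccy_metric eta g (a t) (b t)), (fun t => ccy_vol eta (a t) (b t)).
split=> [t tT|]; first exact: (G2_structure_ccy hCY hnorm (a_neq0 t tT) (b_neq0 t tT)).
move=> psi t tT i x Ux v.
have psiE s : 0 <= s < 1 / c -> psi s i x v =
    (1 - c * s) `^ (4 / 10) / 2 * wedge (extd (eta i) x) (extd (eta i) x) v
    - eps * wedge (eta i x) (im_form Ups i x) v.
  move=> sT; rewrite -(ab3 s sT) -(bX s 4 sT).
  exact: (dual_ccy_phi hCY hnorm (a_neq0 s sT) (b_neq0 s sT)).
rewrite [X in _ --> X](coflow_rhs_ccy hCY hnorm (a_neq0 t tT) (b_neq0 t tT) v Ux).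
set W := wedge (extd (eta i) x) _ v in psiE *.
have := is_derive_slope [set s : R | 0 <= s < 1 / c] (is_derive_powR_affine (4 / 10) (u_gt0 t tT)).
move=> /(cvgM (cvg_cst (W / 2))) H; rewrite a2//.
(* The constants of the family fit here: with c = 5 eps^2, half of c times 4/10 is eps^2. *)
have -> : - (eps ^+ 2 * (1 - c * t) `^ (4 / 10 - 1)) * W =
    W / 2 * (- c * (4 / 10) * (1 - c * t) `^ (4 / 10 - 1)) by rewrite /c; field.
apply: cvg_trans H; apply: near_eq_cvg; near=> s.
(* [psiE] holds only on the time interval, which [within] provides. *)
have sT : 0 <= s < 1 / c by near: s; exact: withinT.
rewrite /= !psiE//; move: ((s - t)^-1) ((1 - c * s) `^ (4 / 10)) ((1 - c * t) `^ (4 / 10)) => d y z.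
by field.
Unshelve. all: by end_near.
Qed.
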